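(* Let $\mathcal{C}$ be an RF-category and let $F, G : RF_0 \to \mathcal{C}$ be two weak RF-morphisms. Then $F$ and $G$ are isomorphic.
   Context: A CwF is a category with a distinguished terminal object, a presheaf of types $\mathrm{Ty}$, a presheaf of terms $\mathrm{Tm}$ on $\int\mathrm{Ty}$, and context extensions $\Gamma.A$ representing $(\Delta,\sigma)\mapsto\mathrm{Tm}_\Delta(A[\sigma])$. A CwF morphism is a functor with natural actions on types and terms, preserving the terminal object, such that the canonical comparison $F(\Gamma.A)\to F\Gamma.FA$ is an isomorphism; it is split if it preserves terminal object and context extension on the nose. An RF-category is a CwF with $\Pi$-, $\Sigma$-, extensional equality and unit type structures and a universe ($\mathcal{U}\in\mathrm{Ty}(1)$, $\mathsf{El}\in\mathrm{Ty}(1.\mathcal{U})$). An RF-morphism is a CwF morphism preserving all this structure strictly; a weak RF-morphism is a CwF morphism preserving all this structure up to isomorphism. $RF_0$ is the initial object of the category of RF-categories and split RF-morphisms. *)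

(* Defs.v *)
(* Standard Rocq, no library beyond the prelude. *)

Set Implicit Arguments.
Unset Strict Implicit.
Unset Printing Implicit Defensive.

Declare Scope cwf_scope.
Delimit Scope cwf_scope with cwf.
Local Open Scope cwf_scope.

Reserved Notation "s ∘ t" (at level 40, left associativity).
Reserved Notation "A ⟦ s ⟧" (at level 1, left associativity, format "A ⟦ s ⟧").
Reserved Notation "G ▷ A" (at level 38, left associativity).

(** ** Categories with families

   [tm] is a presheaf on the category of elements of [ty]: a morphism
   [(Δ, B) -> (Γ, A)] of that category is a substitution [σ : Δ -> Γ] such that
   [B = A⟦σ⟧], and [tm_sub] takes the equation as an argument.  Throughout, a
   law quantifies over equations of types that either specify such morphisms or
   are consequences of the other laws; in the latter case the quantifier is
   never vacuous, it only says that the choice of proof is immaterial, and it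
   dispenses with transports along type equalities. *)
Record CwF : Type := {
  ctx :> Type;
  sub : ctx -> ctx -> Type;
  id_sub : forall Γ : ctx, sub Γ Γ;
  comp : forall Γ Δ Θ : ctx, sub Δ Γ -> sub Θ Δ -> sub Θ Γ
    where "s ∘ t" := (comp s t) : cwf_scope;
  comp_id_l : forall (Γ Δ : ctx) (σ : sub Δ Γ), id_sub Γ ∘ σ = σ;
  comp_id_r : forall (Γ Δ : ctx) (σ : sub Δ Γ), σ ∘ id_sub Δ = σ;
  comp_assoc : forall (Γ Δ Θ Ξ : ctx) (σ : sub Δ Γ) (τ : sub Θ Δ) (ρ : sub Ξ Θ),
    σ ∘ (τ ∘ ρ) = σ ∘ τ ∘ ρ;

  empty : ctx;
  bang : forall Γ : ctx, sub Γ empty;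
  bang_unique : forall (Γ : ctx) (σ : sub Γ empty), σ = bang Γ;

  ty : ctx -> Type;
  ty_sub : forall Γ Δ : ctx, ty Γ -> sub Δ Γ -> ty Δ
    where "A ⟦ s ⟧" := (ty_sub A s) : cwf_scope;
  ty_sub_id : forall (Γ : ctx) (A : ty Γ), A⟦id_sub Γ⟧ = A;
  ty_sub_comp : forall (Γ Δ Θ : ctx) (A : ty Γ) (σ : sub Δ Γ) (τ : sub Θ Δ),
    A⟦σ ∘ τ⟧ = A⟦σ⟧⟦τ⟧;

  tm : forall Γ : ctx, ty Γ -> Type;
  tm_sub : forall (Γ Δ : ctx) (A : ty Γ) (B : ty Δ) (σ : sub Δ Γ),
    B = A⟦σ⟧ -> tm A -> tm B;
  tm_sub_id : forall (Γ : ctx) (A : ty Γ) (e : A = A⟦id_sub Γ⟧) (a : tm A),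
    tm_sub e a = a;
  tm_sub_comp : forall (Γ Δ Θ : ctx) (A : ty Γ) (B : ty Δ) (C : ty Θ)
      (σ : sub Δ Γ) (τ : sub Θ Δ)
      (e : B = A⟦σ⟧) (e' : C = B⟦τ⟧) (e'' : C = A⟦σ ∘ τ⟧) (a : tm A),
    tm_sub e'' a = tm_sub e' (tm_sub e a);

  (* [(wk A, var A)] is the universal element of [(Δ, σ) |-> tm (A⟦σ⟧)]. *)
  ext : forall Γ : ctx, ty Γ -> ctx
    where "G ▷ A" := (@ext G A) : cwf_scope;
  wk : forall (Γ : ctx) (A : ty Γ), sub (Γ ▷ A) Γ;
  var : forall (Γ : ctx) (A : ty Γ), tm (A⟦wk A⟧);
  pair : forall (Γ Δ : ctx) (A : ty Γ) (σ : sub Δ Γ), tm (A⟦σ⟧) -> sub Δ (Γ ▷ A);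
  wk_pair : forall (Γ Δ : ctx) (A : ty Γ) (σ : sub Δ Γ) (a : tm (A⟦σ⟧)),
    wk A ∘ pair a = σ;
  var_pair : forall (Γ Δ : ctx) (A : ty Γ) (σ : sub Δ Γ) (a : tm (A⟦σ⟧))
      (e : A⟦σ⟧ = A⟦wk A⟧⟦pair a⟧),
    tm_sub e (var A) = a;
  pair_eta : forall (Γ Δ : ctx) (A : ty Γ) (σ : sub Δ (Γ ▷ A))
      (e : A⟦wk A ∘ σ⟧ = A⟦wk A⟧⟦σ⟧),
    pair (tm_sub e (var A)) = σ
}.

Arguments sub {_} _ _.
Arguments id_sub {_} _.
Arguments comp {_ _ _ _} _ _.
Arguments empty {_}.
Arguments bang {_} _.
Arguments ty {_} _.
Arguments ty_sub {_ _ _} _ _.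
Arguments tm {_ _} _.
Arguments tm_sub {_ _ _ _ _} σ e a.
Arguments ext {_} _ _.
Arguments wk {_ _} A.
Arguments var {_ _} A.
Arguments pair {_ _ _} A σ a.

Notation "s ∘ t" := (comp s t) : cwf_scope.
Notation "A ⟦ s ⟧" := (ty_sub A s) : cwf_scope.
Notation "G ▷ A" := (ext G A) : cwf_scope.

Section CwFTheory.
Variable C : CwF.
Implicit Types Γ Δ Θ : C.

Definition is_iso Γ Δ (f : sub Γ Δ) : Prop :=
  exists g : sub Δ Γ, g ∘ f = id_sub Γ /\ f ∘ g = id_sub Δ.

Definition is_terminal (T : C) : Prop :=
  forall Γ, exists f : sub Γ T, forall g : sub Γ T, g = f.

(* [f : Γ -> Δ] is an identity: [Γ = Δ], and [f] is the identity along this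
   equation. *)
Inductive is_identity Γ : forall Δ, sub Γ Δ -> Prop :=
  | is_identity_id : is_identity (id_sub Γ).

Definition tm_cast Γ (A B : ty Γ) (e : A = B) (a : tm A) : tm B :=
  eq_rect A (fun X => tm X) a B e.

Lemma ext_map_ty Γ Δ (A : ty Γ) (B : ty Δ) (σ : sub Δ Γ) (e : B = A⟦σ⟧) :
  B⟦wk B⟧ = A⟦σ ∘ wk B⟧.
Proof. rewrite e. symmetry. apply ty_sub_comp. Qed.

(* The functor sending a morphism of the category of elements of [ty] to the
   induced morphism of context extensions. *)
Definition ext_map Γ Δ (A : ty Γ) (B : ty Δ) (σ : sub Δ Γ) (e : B = A⟦σ⟧) :
    sub (Δ ▷ B) (Γ ▷ A) :=
  pair A (σ ∘ wk B) (tm_cast (ext_map_ty e) (var B)).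

Definition lift Γ Δ (A : ty Γ) (σ : sub Δ Γ) : sub (Δ ▷ A⟦σ⟧) (Γ ▷ A) :=
  ext_map (eq_refl (A⟦σ⟧)).

Definition sing Γ (A : ty Γ) (a : tm A) : sub Γ (Γ ▷ A) :=
  pair A (id_sub Γ) (tm_sub (id_sub Γ) eq_refl a).

(* [f] exhibits [A] as isomorphic to [B] over [σ]. *)
Definition ty_iso_over Γ Δ (A : ty Γ) (B : ty Δ) (σ : sub Δ Γ)
    (f : sub (Δ ▷ B) (Γ ▷ A)) : Prop :=
  wk A ∘ f = σ ∘ wk B /\ is_iso f.

(* Auxiliary equations, used below to type the comparison morphisms. *)

Lemma tm_sub_irr Γ Δ (A : ty Γ) (B : ty Δ) (σ : sub Δ Γ) (e e' : B = A⟦σ⟧) (a : tm A) :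
  tm_sub σ e a = tm_sub σ e' a.
Proof.
assert (e0 : B = B⟦id_sub Δ⟧) by (symmetry; apply ty_sub_id).
assert (e1 : B = A⟦σ ∘ id_sub Δ⟧) by (rewrite comp_id_r; exact e).
rewrite <- (tm_sub_id e0 (tm_sub σ e a)), <- (tm_sub_id e0 (tm_sub σ e' a)).
rewrite <- (tm_sub_comp e e0 e1), <- (tm_sub_comp e' e0 e1).
reflexivity.
Qed.

Lemma tm_sub_eq Γ Δ (A : ty Γ) (B : ty Δ) (σ σ' : sub Δ Γ)
    (e : B = A⟦σ⟧) (e' : B = A⟦σ'⟧) (a : tm A) :
  σ = σ' -> tm_sub σ e a = tm_sub σ' e' a.
Proof. intros H. destruct H. apply tm_sub_irr. Qed.

Lemma tm_cast_irr Γ (A B : ty Γ) (e e' : A = B) (a : tm A) :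
  tm_cast e a = tm_cast e' a.
Proof.
assert (H : forall e : A = B, forall e0 : B = A⟦id_sub Γ⟧,
  tm_cast e a = tm_sub (id_sub Γ) e0 a).
{ intros d. destruct d. intros e0. symmetry. apply tm_sub_id. }
assert (e0 : B = A⟦id_sub Γ⟧) by (rewrite ty_sub_id; symmetry; exact e).
rewrite (H e e0), (H e' e0). reflexivity.
Qed.

Lemma tm_cast_trans Γ (A B X : ty Γ) (e : A = B) (e' : B = X) (a : tm A) :
  tm_cast e' (tm_cast e a) = tm_cast (eq_trans e e') a.
Proof. destruct e'. reflexivity. Qed.

Lemma cast_tm_sub Γ Δ (A : ty Γ) (B B' : ty Δ) (σ : sub Δ Γ) (e : B = B')
    (e' : B = A⟦σ⟧) (e'' : B' = A⟦σ⟧) (a : tm A) :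
  tm_cast e (tm_sub σ e' a) = tm_sub σ e'' a.
Proof. destruct e. apply tm_sub_irr. Qed.

Lemma tm_sub_cast Γ Δ (A A' : ty Γ) (B : ty Δ) (σ : sub Δ Γ) (e : A = A')
    (e' : B = A'⟦σ⟧) (e'' : B = A⟦σ⟧) (a : tm A) :
  tm_sub σ e' (tm_cast e a) = tm_sub σ e'' a.
Proof. destruct e. apply tm_sub_irr. Qed.

(* Two substitutions into [Γ ▷ A] agree as soon as their components do. *)
Lemma sub_ext_eq Γ Δ (A : ty Γ) (f g : sub Δ (Γ ▷ A)) (X : ty Δ)
    (e1 : X = A⟦wk A⟧⟦f⟧) (e2 : X = A⟦wk A⟧⟦g⟧) :
  wk A ∘ f = wk A ∘ g -> tm_sub f e1 (var A) = tm_sub g e2 (var A) -> f = g.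
Proof.
intros H.
assert (eX : X = A⟦wk A ∘ f⟧) by (rewrite ty_sub_comp; exact e1).
revert e1 e2. rewrite eX. intros e1 e2 K. rewrite <- (pair_eta e1), K. clear K.
revert e2. rewrite H. intros e2. apply pair_eta.
Qed.

Lemma pair_tm_ty Γ Δ (A : ty Γ) (σ : sub Δ Γ) (a : tm A⟦σ⟧) :
  A⟦σ⟧ = A⟦wk A⟧⟦pair A σ a⟧.
Proof. rewrite <- ty_sub_comp, wk_pair. reflexivity. Qed.

Lemma var_pair_cast Γ Δ (A : ty Γ) (σ : sub Δ Γ) (a : tm A⟦σ⟧) (X : ty Δ)
    (e : X = A⟦wk A⟧⟦pair A σ a⟧) (e' : A⟦σ⟧ = X) :
  tm_sub (pair A σ a) e (var A) = tm_cast e' a.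
Proof. destruct e'. apply var_pair. Qed.

Lemma pair_comp_eq Γ Δ Θ (A : ty Γ) (σ : sub Δ Γ) (a : tm A⟦σ⟧) (τ : sub Θ Δ)
    (ρ : sub Θ Γ) (b : tm A⟦ρ⟧) (e : A⟦ρ⟧ = A⟦σ⟧⟦τ⟧) :
  σ ∘ τ = ρ -> tm_sub τ e a = b -> pair A σ a ∘ τ = pair A ρ b.
Proof.
intros H K.
assert (e1 : A⟦ρ⟧ = A⟦wk A⟧⟦pair A σ a ∘ τ⟧).
{ rewrite <- ty_sub_comp, comp_assoc, wk_pair, H. reflexivity. }
apply (@sub_ext_eq _ _ _ _ _ _ e1 (pair_tm_ty b)).
- rewrite comp_assoc, !wk_pair. exact H.
- rewrite (tm_sub_comp (pair_tm_ty a) e e1), !var_pair. exact K.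
Qed.

Lemma lift_sing Γ Δ (A : ty Γ) (σ : sub Δ Γ) (a : tm A⟦σ⟧) :
  lift A σ ∘ sing a = pair A σ a.
Proof.
assert (H : σ ∘ wk A⟦σ⟧ ∘ sing a = σ).
{ rewrite <- comp_assoc. unfold sing. rewrite wk_pair. apply comp_id_r. }
assert (e : A⟦σ⟧ = A⟦σ ∘ wk A⟦σ⟧⟧⟦sing a⟧).
{ rewrite <- ty_sub_comp, H. reflexivity. }
apply (@pair_comp_eq _ _ _ _ _ _ _ _ _ e H).
assert (e' : A⟦σ⟧ = A⟦σ⟧⟦wk A⟦σ⟧⟧⟦sing a⟧) 
  by (rewrite <- !ty_sub_comp, comp_assoc, H; reflexivity).
rewrite (tm_sub_cast _ _ e').
unfold sing in *. rewrite (var_pair_cast e' (ty_sub_id _)).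
rewrite (cast_tm_sub (ty_sub_id _) _ (eq_sym (ty_sub_id _))).
apply tm_sub_id.
Qed.

Lemma ext_map_comp_id Γ Δ (A : ty Γ) (B : ty Δ) (σ : sub Δ Γ) (e : B = A⟦σ⟧)
    (e' : A⟦σ⟧ = B⟦id_sub Δ⟧) :
  ext_map e ∘ ext_map e' = lift A σ.
Proof.
revert e'. subst B. intros e'.
assert (H : σ ∘ wk A⟦σ⟧ ∘ ext_map e' = σ ∘ wk A⟦σ⟧).
{ unfold ext_map. rewrite <- comp_assoc, wk_pair, comp_id_l. reflexivity. }
assert (e1 : A⟦σ ∘ wk A⟦σ⟧⟧ = A⟦σ ∘ wk A⟦σ⟧⟧⟦ext_map e'⟧).
{ rewrite <- ty_sub_comp, H. reflexivity. }
apply (@pair_comp_eq _ _ _ _ _ _ _ _ _ e1 H).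
assert (e2 : A⟦σ ∘ wk A⟦σ⟧⟧ = A⟦σ⟧⟦wk A⟦σ⟧⟧⟦ext_map e'⟧).
{ rewrite <- (ty_sub_comp A). exact e1. }
rewrite (tm_sub_cast _ _ e2).
unfold ext_map in *.
assert (e3 : A⟦σ⟧⟦id_sub Δ ∘ wk A⟦σ⟧⟧ = A⟦σ ∘ wk A⟦σ⟧⟧).
{ rewrite comp_id_l. symmetry. apply ty_sub_comp. }
rewrite (var_pair_cast e2 e3).
rewrite tm_cast_trans. apply tm_cast_irr.
Qed.

End CwFTheory.

(** ** Type structures *)

(* [app] is application in context, inverse to [lam]; ordinary application is
   [(app f)⟦sing a⟧].  Stability of [app] under substitution follows from that
   of [lam]. *)
Record PiStructure (C : CwF) : Type := {
  Pi : forall (Γ : C) (A : ty Γ), ty (Γ ▷ A) -> ty Γ;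
  lam : forall (Γ : C) (A : ty Γ) (B : ty (Γ ▷ A)), tm B -> tm (Pi B);
  app : forall (Γ : C) (A : ty Γ) (B : ty (Γ ▷ A)), tm (Pi B) -> tm B;
  Pi_beta : forall (Γ : C) (A : ty Γ) (B : ty (Γ ▷ A)) (b : tm B),
    app (lam b) = b;
  Pi_eta : forall (Γ : C) (A : ty Γ) (B : ty (Γ ▷ A)) (f : tm (Pi B)),
    lam (app f) = f;
  Pi_sub : forall (Γ Δ : C) (A : ty Γ) (B : ty (Γ ▷ A)) (σ : sub Δ Γ),
    (Pi B)⟦σ⟧ = Pi B⟦lift A σ⟧;
  lam_sub : forall (Γ Δ : C) (A : ty Γ) (B : ty (Γ ▷ A)) (σ : sub Δ Γ) (b : tm B)
      (e : Pi B⟦lift A σ⟧ = (Pi B)⟦σ⟧),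
    tm_sub σ e (lam b) = lam (tm_sub (lift A σ) eq_refl b)
}.

(* Stability of [fst] and [snd] follows from that of [spair]. *)
Record SigmaStructure (C : CwF) : Type := {
  Sigma : forall (Γ : C) (A : ty Γ), ty (Γ ▷ A) -> ty Γ;
  spair : forall (Γ : C) (A : ty Γ) (B : ty (Γ ▷ A)) (a : tm A),
    tm B⟦sing a⟧ -> tm (Sigma B);
  fst : forall (Γ : C) (A : ty Γ) (B : ty (Γ ▷ A)), tm (Sigma B) -> tm A;
  snd : forall (Γ : C) (A : ty Γ) (B : ty (Γ ▷ A)) (t : tm (Sigma B)),
    tm B⟦sing (fst t)⟧;
  fst_spair : forall (Γ : C) (A : ty Γ) (B : ty (Γ ▷ A)) (a : tm A)
      (b : tm B⟦sing a⟧),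
    fst (spair b) = a;
  snd_spair : forall (Γ : C) (A : ty Γ) (B : ty (Γ ▷ A)) (a : tm A)
      (b : tm B⟦sing a⟧) (e : B⟦sing (fst (spair b))⟧ = B⟦sing a⟧),
    tm_cast e (snd (spair b)) = b;
  spair_eta : forall (Γ : C) (A : ty Γ) (B : ty (Γ ▷ A)) (t : tm (Sigma B)),
    spair (snd t) = t;
  Sigma_sub : forall (Γ Δ : C) (A : ty Γ) (B : ty (Γ ▷ A)) (σ : sub Δ Γ),
    (Sigma B)⟦σ⟧ = Sigma B⟦lift A σ⟧;
  spair_sub : forall (Γ Δ : C) (A : ty Γ) (B : ty (Γ ▷ A)) (σ : sub Δ Γ) (a : tm A)
      (b : tm B⟦sing a⟧)
      (e : Sigma B⟦lift A σ⟧ = (Sigma B)⟦σ⟧)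
      (e' : B⟦lift A σ⟧⟦sing (tm_sub σ eq_refl a)⟧ = B⟦sing a⟧⟦σ⟧),
    tm_sub σ e (spair b) = spair (tm_sub σ e' b)
}.

(* Extensional: equality reflection and uniqueness of equality proofs.  By
   uniqueness, [refl] is stable under substitution. *)
Record EqStructure (C : CwF) : Type := {
  Eq : forall (Γ : C) (A : ty Γ), tm A -> tm A -> ty Γ;
  refl : forall (Γ : C) (A : ty Γ) (a : tm A), tm (Eq a a);
  Eq_reflection : forall (Γ : C) (A : ty Γ) (a b : tm A), tm (Eq a b) -> a = b;
  Eq_unique : forall (Γ : C) (A : ty Γ) (a b : tm A) (t u : tm (Eq a b)), t = u;
  Eq_sub : forall (Γ Δ : C) (A : ty Γ) (a b : tm A) (σ : sub Δ Γ),
    (Eq a b)⟦σ⟧ = Eq (tm_sub σ eq_refl a) (tm_sub σ eq_refl b)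
}.

Record UnitStructure (C : CwF) : Type := {
  Unit : forall Γ : C, ty Γ;
  star : forall Γ : C, tm (Unit Γ);
  Unit_eta : forall (Γ : C) (t : tm (Unit Γ)), t = star Γ;
  Unit_sub : forall (Γ Δ : C) (σ : sub Δ Γ), (Unit Γ)⟦σ⟧ = Unit Δ
}.

Record Universe (C : CwF) : Type := {
  U : ty (@empty C);
  El : ty (@empty C ▷ U)
}.

Record RFCat : Type := {
  cwf :> CwF;
  pi_str :> PiStructure cwf;
  sigma_str :> SigmaStructure cwf;
  eq_str :> EqStructure cwf;
  unit_str :> UnitStructure cwf;
  universe :> Universe cwf
}.

Arguments Pi {C} _ {Γ A} B.
Arguments lam {C} _ {Γ A B} b.
Arguments app {C} _ {Γ A B} f.
Arguments Sigma {C} _ {Γ A} B.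
Arguments spair {C} _ {Γ A B a} b.
Arguments fst {C} _ {Γ A B} t.
Arguments snd {C} _ {Γ A B} t.
Arguments Eq {C} _ {Γ A} a b.
Arguments refl {C} _ {Γ A} a.
Arguments Unit {C} _ Γ.
Arguments star {C} _ Γ.
Arguments U {C} _.
Arguments El {C} _.

(** ** Morphisms of categories with families *)

(* A functor with natural actions on types and terms. *)
Record CwFPreMor (C D : CwF) : Type := {
  on_ctx :> C -> D;
  on_sub : forall Γ Δ : C, sub Δ Γ -> sub (on_ctx Δ) (on_ctx Γ);
  on_id : forall Γ : C, on_sub (id_sub Γ) = id_sub (on_ctx Γ);
  on_comp : forall (Γ Δ Θ : C) (σ : sub Δ Γ) (τ : sub Θ Δ),
    on_sub (σ ∘ τ) = on_sub σ ∘ on_sub τ;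
  on_ty : forall Γ : C, ty Γ -> ty (on_ctx Γ);
  on_ty_sub : forall (Γ Δ : C) (A : ty Γ) (σ : sub Δ Γ),
    on_ty A⟦σ⟧ = (on_ty A)⟦on_sub σ⟧;
  on_tm : forall (Γ : C) (A : ty Γ), tm A -> tm (on_ty A);
  on_tm_sub : forall (Γ Δ : C) (A : ty Γ) (B : ty Δ) (σ : sub Δ Γ)
      (e : B = A⟦σ⟧) (e' : on_ty B = (on_ty A)⟦on_sub σ⟧) (a : tm A),
    on_tm (tm_sub σ e a) = tm_sub (on_sub σ) e' (on_tm a)
}.

Arguments on_sub {C D} _ {Γ Δ} σ.
Arguments on_ty {C D} _ {Γ} A.
Arguments on_ty_sub {C D} _ {Γ Δ} A σ.
Arguments on_tm {C D} _ {Γ A} a.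

(* The canonical comparison F(Γ.A) -> FΓ.FA *)
Definition ext_cmp (C D : CwF) (F : CwFPreMor C D) (Γ : C) (A : ty Γ) :
    sub (F (Γ ▷ A)) (F Γ ▷ on_ty F A) :=
  pair (on_ty F A) (on_sub F (wk A)) (tm_cast (on_ty_sub F A (wk A)) (on_tm F (var A))).

Record CwFMor (C D : CwF) : Type := {
  pre_mor :> CwFPreMor C D;
  on_empty : is_terminal (pre_mor empty);
  ext_inv : forall (Γ : C) (A : ty Γ), sub (pre_mor Γ ▷ on_ty pre_mor A) (pre_mor (Γ ▷ A));
  ext_inv_l : forall (Γ : C) (A : ty Γ),
    ext_inv A ∘ ext_cmp pre_mor A = id_sub (pre_mor (Γ ▷ A));
  ext_inv_r : forall (Γ : C) (A : ty Γ),
    ext_cmp pre_mor A ∘ ext_inv A = id_sub (pre_mor Γ ▷ on_ty pre_mor A)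
}.

Arguments ext_inv {C D} _ {Γ} A.

Definition is_split (C D : CwF) (F : CwFMor C D) : Prop :=
  F empty = empty /\
  forall (Γ : C) (A : ty Γ), is_identity (ext_cmp F A).

Section Comparison.
Variables (C D : CwF) (F : CwFMor C D).

(* The action of [F] on a family [B] over [A], as a family over [F A]. *)
Definition on_fam (Γ : C) (A : ty Γ) (B : ty (Γ ▷ A)) : ty (F Γ ▷ on_ty F A) :=
  (on_ty F B)⟦ext_inv F A⟧.

Lemma on_tm_cast (Γ : C) (A B : ty Γ) (e : A = B) (a : tm A) :
  on_tm F (tm_cast e a) = tm_cast (f_equal (on_ty F (Γ := Γ)) e) (on_tm F a).
Proof. destruct e. reflexivity. Qed.

Lemma ext_cmp_pair (Γ Δ : C) (A : ty Γ) (σ : sub Δ Γ) (a : tm A⟦σ⟧) :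
  ext_cmp F A ∘ on_sub F (pair A σ a) =
  pair (on_ty F A) (on_sub F σ) (tm_cast (on_ty_sub F A σ) (on_tm F a)).
Proof.
assert (H : on_sub F (wk A) ∘ on_sub F (pair A σ a) = on_sub F σ).
{ rewrite <- on_comp, wk_pair. reflexivity. }
assert (e : (on_ty F A)⟦on_sub F σ⟧
  = (on_ty F A)⟦on_sub F (wk A)⟧⟦on_sub F (pair A σ a)⟧).
{ rewrite <- ty_sub_comp, H. reflexivity. }
apply (@pair_comp_eq _ _ _ _ _ _ _ _ _ _ e H).
assert (e' : (on_ty F A)⟦on_sub F σ⟧ = (on_ty F A⟦wk A⟧)⟦on_sub F (pair A σ a)⟧).
{ rewrite on_ty_sub. exact e. }
rewrite (tm_sub_cast _ _ e').
assert (e2 : on_ty F A⟦σ⟧ = (on_ty F A⟦wk A⟧)⟦on_sub F (pair A σ a)⟧).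
{ rewrite on_ty_sub. exact e'. }
rewrite <- (cast_tm_sub (on_ty_sub F A σ) e2).
f_equal. rewrite <- (on_tm_sub (pair_tm_ty a)), var_pair. reflexivity.
Qed.

Lemma ext_cmp_ext_map (Γ Δ : C) (A : ty Γ) (B : ty Δ) (σ : sub Δ Γ) (e : B = A⟦σ⟧)
    (e' : on_ty F B = (on_ty F A)⟦on_sub F σ⟧) :
  ext_cmp F A ∘ on_sub F (ext_map e) = ext_map e' ∘ ext_cmp F B.
Proof.
unfold ext_map at 1. rewrite ext_cmp_pair. symmetry.
assert (H : on_sub F σ ∘ wk (on_ty F B) ∘ ext_cmp F B = on_sub F (σ ∘ wk B)).
{ unfold ext_cmp. rewrite <- comp_assoc, wk_pair. symmetry. apply on_comp. }
assert (e1 : (on_ty F A)⟦on_sub F (σ ∘ wk B)⟧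
  = (on_ty F A)⟦on_sub F σ ∘ wk (on_ty F B)⟧⟦ext_cmp F B⟧).
{ rewrite <- ty_sub_comp, H. reflexivity. }
apply (@pair_comp_eq _ _ _ _ _ _ _ _ _ _ e1 H).
assert (e2 : (on_ty F A)⟦on_sub F (σ ∘ wk B)⟧
  = (on_ty F B)⟦wk (on_ty F B)⟧⟦ext_cmp F B⟧).
{ rewrite e1, <- (ext_map_ty e'). reflexivity. }
rewrite (tm_sub_cast _ _ e2).
assert (e3 : (on_ty F B)⟦on_sub F (wk B)⟧ = (on_ty F A)⟦on_sub F (σ ∘ wk B)⟧).
{ rewrite on_comp, e', <- ty_sub_comp. reflexivity. }
unfold ext_cmp in *. rewrite (var_pair_cast e2 e3).
rewrite on_tm_cast, !tm_cast_trans. apply tm_cast_irr.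
Qed.

Lemma on_fam_pair (Γ Δ : C) (A : ty Γ) (B : ty (Γ ▷ A)) (σ : sub Δ Γ) (a : tm A⟦σ⟧) :
  on_ty F B⟦pair A σ a⟧
  = (on_fam B)⟦pair (on_ty F A) (on_sub F σ) (tm_cast (on_ty_sub F A σ) (on_tm F a))⟧.
Proof.
unfold on_fam.
rewrite <- ext_cmp_pair, <- ty_sub_comp, comp_assoc, ext_inv_l, comp_id_l.
apply on_ty_sub.
Qed.

Lemma on_fam_sing (Γ : C) (A : ty Γ) (B : ty (Γ ▷ A)) (a : tm A) :
  on_ty F B⟦sing a⟧ = (on_fam B)⟦sing (on_tm F a)⟧.
Proof.
unfold sing at 1. rewrite on_fam_pair. f_equal.
rewrite <- (comp_id_r (pair _ _ _)).
assert (H : on_sub F (id_sub Γ) ∘ id_sub (F Γ) = id_sub (F Γ)).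
{ rewrite comp_id_r. apply on_id. }
assert (e : (on_ty F A)⟦id_sub (F Γ)⟧ = (on_ty F A)⟦on_sub F (id_sub Γ)⟧⟦id_sub (F Γ)⟧).
{ rewrite <- ty_sub_comp, H. reflexivity. }
apply (@pair_comp_eq _ _ _ _ _ _ _ _ _ _ e H).
assert (e1 : (on_ty F A)⟦id_sub (F Γ)⟧ = (on_ty F A⟦id_sub Γ⟧)⟦id_sub (F Γ)⟧).
{ rewrite on_ty_sub. exact e. }
rewrite (tm_sub_cast _ _ e1).
assert (e2 : on_ty F A⟦id_sub Γ⟧ = (on_ty F A)⟦on_sub F (id_sub Γ)⟧) by apply on_ty_sub.
rewrite (on_tm_sub eq_refl e2).
assert (e3 : (on_ty F A)⟦id_sub (F Γ)⟧
  = (on_ty F A)⟦on_sub F (id_sub Γ) ∘ id_sub (F Γ)⟧) by (rewrite H; reflexivity).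
rewrite <- (tm_sub_comp e2 e1 e3).
apply tm_sub_eq, H.
Qed.

End Comparison.

(** ** Split RF-morphisms *)

Section Strict.
Variables (R S : RFCat) (F : CwFMor R S).

(* Preservation of [app] follows from that of [lam]; similarly for [fst] and
   [snd] below.  Preservation of [refl] and [star] is automatic, by the
   uniqueness laws. *)
Definition strict_Pi : Prop :=
  forall (Γ : R) (A : ty Γ) (B : ty (Γ ▷ A)),
  exists e : on_ty F (Pi R B) = Pi S (on_fam F B),
  forall b : tm B,
    tm_cast e (on_tm F (lam R b)) = lam S (tm_sub (ext_inv F A) eq_refl (on_tm F b)).

Definition strict_Sigma : Prop :=
  forall (Γ : R) (A : ty Γ) (B : ty (Γ ▷ A)),
  exists e : on_ty F (Sigma R B) = Sigma S (on_fam F B),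
  forall (a : tm A) (b : tm B⟦sing a⟧),
    tm_cast e (on_tm F (spair R b)) = spair S (tm_cast (on_fam_sing F B a) (on_tm F b)).

Definition strict_Eq : Prop :=
  forall (Γ : R) (A : ty Γ) (a b : tm A),
  on_ty F (Eq R a b) = Eq S (on_tm F a) (on_tm F b).

Definition strict_Unit : Prop :=
  forall Γ : R, on_ty F (Unit R Γ) = Unit S (F Γ).

(* The universe lives over the terminal object; it is compared along the
   unique [F empty -> empty]. *)
Definition strict_universe : Prop :=
  exists e : on_ty F (U R) = (U S)⟦bang (F empty)⟧,
  on_ty F (El R) = (El S)⟦ext_map e ∘ ext_cmp F (U R)⟧.

End Strict.

Record SplitRFMor (R S : RFCat) : Type := {
  split_mor :> CwFMor R S;
  split_is_split : is_split split_mor;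
  split_Pi : strict_Pi split_mor;
  split_Sigma : strict_Sigma split_mor;
  split_Eq : strict_Eq split_mor;
  split_Unit : strict_Unit split_mor;
  split_universe : strict_universe split_mor
}.

Definition is_initial (R : RFCat) : Prop :=
  forall S : RFCat, exists F : SplitRFMor R S, forall G : SplitRFMor R S, G = F.

(** ** Weak RF-morphisms

   For each type former, [F] acts on terms by sending a term of type
   [(T A ...)⟦σ⟧] to one of type [(T (F A) ...)⟦F σ⟧].  Applied to the universal
   such term, this action gives the canonical comparison
   F(Γ.T(A, ...)) -> FΓ.T(FA, ...) over FΓ, which is required to be invertible. *)

Section Weak.
Variables (R S : RFCat) (F : CwFMor R S).

Lemma ty_sub_id_r (Γ Δ : R) (A : ty Γ) (σ : sub Δ Γ) :
  (on_ty F A)⟦on_sub F σ⟧ = (on_ty F A⟦σ⟧)⟦id_sub (F Δ)⟧.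
Proof. rewrite ty_sub_id. symmetry. apply on_ty_sub. Qed.

(* FΔ.(FA)[Fσ] -> F(Δ.A[σ]) *)
Definition ext_inv_sub (Γ Δ : R) (A : ty Γ) (σ : sub Δ Γ) :
    sub (F Δ ▷ (on_ty F A)⟦on_sub F σ⟧) (F (Δ ▷ A⟦σ⟧)) :=
  ext_inv F A⟦σ⟧ ∘ ext_map (ty_sub_id_r A σ).

Lemma on_fam_lift (Γ Δ : R) (A : ty Γ) (B : ty (Γ ▷ A)) (σ : sub Δ Γ) :
  (on_fam F B)⟦lift (on_ty F A) (on_sub F σ)⟧
  = (on_ty F B⟦lift A σ⟧)⟦ext_inv_sub A σ⟧.
Proof.
unfold on_fam. rewrite on_ty_sub, <- !ty_sub_comp. f_equal.
rewrite <- (ext_map_comp_id (on_ty_sub F A σ) (ty_sub_id_r A σ)).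
unfold ext_inv_sub.
rewrite <- (comp_id_r (ext_map (on_ty_sub F A σ))), <- (ext_inv_r F A⟦σ⟧).
rewrite (comp_assoc (ext_map (on_ty_sub F A σ))).
rewrite <- (@ext_cmp_ext_map _ _ F _ _ _ _ _ (eq_refl A⟦σ⟧)).
rewrite !comp_assoc, ext_inv_l, comp_id_l. reflexivity.
Qed.

Definition on_Pi (Γ Δ : R) (A : ty Γ) (B : ty (Γ ▷ A)) (σ : sub Δ Γ)
    (f : tm (Pi R B)⟦σ⟧) : tm (Pi S (on_fam F B))⟦on_sub F σ⟧ :=
  tm_cast (eq_sym (Pi_sub S (on_fam F B) (on_sub F σ)))
    (lam S (tm_sub (ext_inv_sub A σ) (on_fam_lift B σ)
      (on_tm F (app R (tm_cast (Pi_sub R B σ) f))))).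

Definition Pi_cmp (Γ : R) (A : ty Γ) (B : ty (Γ ▷ A)) :
    sub (F (Γ ▷ Pi R B)) (F Γ ▷ Pi S (on_fam F B)) :=
  pair _ (on_sub F (wk _)) (on_Pi (var (Pi R B))).

Lemma Sigma_cmp_ty (Γ Δ : R) (A : ty Γ) (B : ty (Γ ▷ A)) (σ : sub Δ Γ) (a : tm A⟦σ⟧) :
  on_ty F B⟦lift A σ⟧⟦sing a⟧
  = (on_fam F B)⟦lift (on_ty F A) (on_sub F σ)⟧
      ⟦sing (tm_cast (on_ty_sub F A σ) (on_tm F a))⟧.
Proof. rewrite <- !ty_sub_comp, !lift_sing. apply on_fam_pair. Qed.

Definition on_Sigma (Γ Δ : R) (A : ty Γ) (B : ty (Γ ▷ A)) (σ : sub Δ Γ)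
    (t : tm (Sigma R B)⟦σ⟧) : tm (Sigma S (on_fam F B))⟦on_sub F σ⟧ :=
  let t' := tm_cast (Sigma_sub R B σ) t in
  tm_cast (eq_sym (Sigma_sub S (on_fam F B) (on_sub F σ)))
    (spair S (tm_cast (Sigma_cmp_ty B (fst R t')) (on_tm F (snd R t')))).

Definition Sigma_cmp (Γ : R) (A : ty Γ) (B : ty (Γ ▷ A)) :
    sub (F (Γ ▷ Sigma R B)) (F Γ ▷ Sigma S (on_fam F B)) :=
  pair _ (on_sub F (wk _)) (on_Sigma (var (Sigma R B))).

Lemma Eq_cmp_ty (Γ Δ : R) (A : ty Γ) (a b : tm A) (σ : sub Δ Γ) (t : tm (Eq R a b)⟦σ⟧) :
  let a' := tm_sub (on_sub F σ) eq_refl (on_tm F a) in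
  Eq S a' a' = (Eq S (on_tm F a) (on_tm F b))⟦on_sub F σ⟧.
Proof.
intros a'. rewrite Eq_sub. unfold a'. f_equal.
assert (H := Eq_reflection (tm_cast (Eq_sub R a b σ) t)).
assert (K := f_equal (fun x => tm_cast (on_ty_sub F A σ) (on_tm F x)) H).
simpl in K.
rewrite !(on_tm_sub eq_refl (on_ty_sub F A σ)) in K.
rewrite !(cast_tm_sub (on_ty_sub F A σ) _ eq_refl) in K.
exact K.
Qed.

Definition on_Eq (Γ Δ : R) (A : ty Γ) (a b : tm A) (σ : sub Δ Γ)
    (t : tm (Eq R a b)⟦σ⟧) : tm (Eq S (on_tm F a) (on_tm F b))⟦on_sub F σ⟧ :=
  tm_cast (Eq_cmp_ty t) (refl S (tm_sub (on_sub F σ) eq_refl (on_tm F a))).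

Definition Eq_cmp (Γ : R) (A : ty Γ) (a b : tm A) :
    sub (F (Γ ▷ Eq R a b)) (F Γ ▷ Eq S (on_tm F a) (on_tm F b)) :=
  pair _ (on_sub F (wk _)) (on_Eq (var (Eq R a b))).

Definition Unit_cmp (Γ : R) : sub (F (Γ ▷ Unit R Γ)) (F Γ ▷ Unit S (F Γ)) :=
  pair _ (on_sub F (wk _)) (tm_cast (eq_sym (Unit_sub S (on_sub F (wk _)))) (star S _)).

End Weak.

(* For the universe there is no canonical comparison: the isomorphisms
   [F U ≅ U], over [F empty ≅ empty], and [F El ≅ El], over [F U ≅ U], are part
   of the data. *)
Record WeakRFMor (R S : RFCat) : Type := {
  weak_mor :> CwFMor R S;
  weak_Pi : forall (Γ : R) (A : ty Γ) (B : ty (Γ ▷ A)), is_iso (Pi_cmp weak_mor B);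
  weak_Sigma : forall (Γ : R) (A : ty Γ) (B : ty (Γ ▷ A)), is_iso (Sigma_cmp weak_mor B);
  weak_Eq : forall (Γ : R) (A : ty Γ) (a b : tm A), is_iso (Eq_cmp weak_mor a b);
  weak_Unit : forall Γ : R, is_iso (Unit_cmp weak_mor Γ);
  weak_U : sub (weak_mor empty ▷ on_ty weak_mor (U R)) (empty ▷ U S);
  weak_U_iso : ty_iso_over (bang (weak_mor empty)) weak_U;
  weak_El : sub (weak_mor (empty ▷ U R) ▷ on_ty weak_mor (El R)) (empty ▷ U S ▷ El S);
  weak_El_iso : ty_iso_over (weak_U ∘ ext_cmp weak_mor (U R)) weak_El
}.

(* The component FΓ.FA -> GΓ.GA at a type [A] of a transformation [φ] of the
   underlying functors. *)
Definition ty_component (C D : CwF) (F G : CwFMor C D)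
    (φ : forall Γ : C, sub (F Γ) (G Γ)) (Γ : C) (A : ty Γ) :
    sub (F Γ ▷ on_ty F A) (G Γ ▷ on_ty G A) :=
  ext_cmp G A ∘ φ (Γ ▷ A) ∘ ext_inv F A.

(* A natural isomorphism of the underlying functors.  Naturality at [wk A] and
   at the sections [sing a] says that its components at types are
   isomorphisms [F A ≅ G A] over [φ Γ], and that they send [F a] to [G a]; for
   the universe they are required to agree with the given isomorphisms. *)
Definition isomorphic (R S : RFCat) (F G : WeakRFMor R S) : Prop :=
  exists φ : forall Γ : R, sub (F Γ) (G Γ),
    (forall Γ : R, is_iso (φ Γ)) /\
    (forall (Γ Δ : R) (σ : sub Δ Γ), φ Γ ∘ on_sub F σ = on_sub G σ ∘ φ Δ) /\
    weak_U G ∘ ty_component φ (U R) = weak_U F /\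
    weak_El G ∘ ty_component φ (El R) = weak_El F.

(* Main.v *)
Require Import Defs.
From Stdlib Require Import ProofIrrelevance IndefiniteDescription.

Set Implicit Arguments.
Unset Strict Implicit.
Unset Printing Implicit Defensive.
Local Open Scope cwf_scope.

(** Consider the iso-inserter of [F] and [G]: contexts are pairs of a context [Γ] of
    [RF0] and an isomorphism [FΓ ≅ GΓ], types over it are pairs of a type [A] and an
    isomorphism [F(Γ.A) ≅ G(Γ.A)] over [FΓ ≅ GΓ], substitutions and terms are those of
    [RF0] for which the evident naturality square commutes.  It is an RF-category, since
    [F] and [G] preserve the universal properties that determine the type formers
    (pullbacks of display maps, dependent products, equalizers), and these properties
    produce the required isomorphisms and make them stable under substitution.  The
    projection to [RF0] is a split RF-morphism.  By initiality it has a section, and the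
    second components of the section form the isomorphism [F ≅ G]. *)

(** * Context extensions in a category with families *)

(** The laws of a CwF are equations, so stability of a type former must hold on the nose in the
    iso-inserter. It does because the isomorphism stored in a type is the only one with the required
    squares. Hence two facts are proved for each of Π, Σ, equality and unit: a compatible
    isomorphism exists, and a map into [Γ ▷ T] is natural as soon as its composites with the
    structure maps of [T] are. The universe has no universal property; its isomorphisms are read off
    from [weak_U] and [weak_El]. Components must be invertible because Π is contravariant in its
    domain: from maps [F → G] alone nothing would define a component at [Pi]. A component at [A] is
    a map on [F (Γ ▷ A)] rather than on [F Γ ▷ on_ty F A]. Context extension then keeps the
    component, and all conditions become squares between images under [F] and [G]. The section
    yields components indexed by the projected context, not by [Γ] itself. The final step transports
    them along an equality of split RF-morphisms. *)

Section Substitutions.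
Variable C : CwF.
Implicit Types Γ Δ Θ X : C.

Lemma ty_sub_eq_id Γ (A : ty Γ) (σ : sub Γ Γ) : σ = id_sub Γ -> A = A⟦σ⟧.
Proof. intros ->. symmetry. apply ty_sub_id. Qed.

(** Composition in the category of elements of [ty]; [ty_sub_factor] is the corresponding
    cancellation. The composite [ρ] is a variable with an equation, so that a substitution known in
    another form can be used without transport. *)
Lemma ty_sub_trans Γ Δ Θ (A : ty Γ) (B : ty Δ) (D : ty Θ) (σ : sub Δ Γ)
    (τ : sub Θ Δ) (ρ : sub Θ Γ) :
  B = A⟦σ⟧ -> D = B⟦τ⟧ -> σ ∘ τ = ρ -> D = A⟦ρ⟧.
Proof. intros -> -> <-. symmetry. apply ty_sub_comp. Qed.

Lemma ty_sub_factor Γ Δ Θ (A : ty Γ) (B : ty Δ) (D : ty Θ) (σ : sub Δ Γ)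
    (τ : sub Θ Δ) (ρ : sub Θ Γ) :
  B = A⟦σ⟧ -> D = A⟦ρ⟧ -> σ ∘ τ = ρ -> D = B⟦τ⟧.
Proof. intros -> -> <-. apply ty_sub_comp. Qed.

Lemma wk_ext_map Γ Δ (A : ty Γ) (B : ty Δ) (σ : sub Δ Γ) (e : B = A⟦σ⟧) :
  wk A ∘ ext_map e = σ ∘ wk B.
Proof. apply wk_pair. Qed.

Lemma wk_lift Γ Δ (A : ty Γ) (σ : sub Δ Γ) : wk A ∘ lift A σ = σ ∘ wk A⟦σ⟧.
Proof. apply wk_pair. Qed.

Lemma wk_sing Γ (A : ty Γ) (a : tm A) : wk A ∘ sing a = id_sub Γ.
Proof. apply wk_pair. Qed.

Lemma var_sing Γ (A : ty Γ) (a : tm A) (e : A = A⟦wk A⟧⟦sing a⟧) :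
  tm_sub (sing a) e (var A) = a.
Proof.
unfold sing in *. rewrite (var_pair_cast e (ty_sub_id A)).
rewrite (cast_tm_sub (ty_sub_id _) _ (eq_sym (ty_sub_id _))).
apply tm_sub_id.
Qed.

(** The second component of [ext_map e] is the variable of [B] up to a cast. With [sub_ext_eq], this
    settles equations between maps that pass through [ext_map]. *)
Lemma var_ext_map Γ Δ X (A : ty Γ) (B : ty Δ) (σ : sub Δ Γ) (e : B = A⟦σ⟧)
    (f : sub X (Δ ▷ B)) (D : ty X) (e1 : D = A⟦wk A⟧⟦ext_map e ∘ f⟧)
    (e2 : D = B⟦wk B⟧⟦f⟧) :
  tm_sub (ext_map e ∘ f) e1 (var A) = tm_sub f e2 (var B).
Proof.
assert (e3 : B⟦wk B⟧ = A⟦wk A⟧⟦ext_map e⟧).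
{ rewrite <- ty_sub_comp, wk_ext_map. exact (ty_sub_trans e eq_refl eq_refl). }
rewrite (tm_sub_comp e3 e2 e1). f_equal.
unfold ext_map in *.
rewrite (var_pair_cast e3 (eq_sym (ext_map_ty e))), tm_cast_trans.
rewrite (tm_cast_irr _ eq_refl). reflexivity.
Qed.

(** A term of [B] over [u] is a term of [A] over [σ ∘ u]. So [ext_map e] and the two display maps
    form a pullback square: this is the uniqueness half, and [ext_map_ex] is the existence half. *)
Lemma ext_map_inj Γ Δ X (A : ty Γ) (B : ty Δ) (σ : sub Δ Γ) (e : B = A⟦σ⟧)
    (f g : sub X (Δ ▷ B)) :
  wk B ∘ f = wk B ∘ g -> ext_map e ∘ f = ext_map e ∘ g -> f = g.
Proof.
intros H K.
assert (e1 : B⟦wk B ∘ f⟧ = B⟦wk B⟧⟦f⟧) by apply ty_sub_comp.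
assert (e2 : B⟦wk B ∘ f⟧ = B⟦wk B⟧⟦g⟧) by (rewrite H; apply ty_sub_comp).
apply (@sub_ext_eq _ _ _ _ _ _ _ e1 e2 H).
assert (e3 : B⟦wk B ∘ f⟧ = A⟦wk A⟧⟦ext_map e ∘ f⟧).
{ rewrite <- ty_sub_comp, comp_assoc, wk_ext_map, <- comp_assoc.
  exact (ty_sub_trans e eq_refl eq_refl). }
assert (e4 : B⟦wk B ∘ f⟧ = A⟦wk A⟧⟦ext_map e ∘ g⟧) by (rewrite <- K; exact e3).
rewrite <- (var_ext_map e3), <- (var_ext_map e4).
apply tm_sub_eq, K.
Qed.

Lemma ext_map_ex Γ Δ X (A : ty Γ) (B : ty Δ) (σ : sub Δ Γ) (e : B = A⟦σ⟧)
    (u : sub X Δ) (v : sub X (Γ ▷ A)) :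
  σ ∘ u = wk A ∘ v -> exists w, wk B ∘ w = u /\ ext_map e ∘ w = v.
Proof.
intros H.
assert (e1 : B⟦u⟧ = A⟦wk A⟧⟦v⟧).
{ rewrite e, <- !ty_sub_comp, H. reflexivity. }
exists (pair B u (tm_sub v e1 (var A))).
split; [apply wk_pair|].
assert (e2 : B⟦u⟧ = A⟦wk A⟧⟦ext_map e ∘ pair B u (tm_sub v e1 (var A))⟧).
{ rewrite <- ty_sub_comp, comp_assoc, wk_ext_map, <- comp_assoc, wk_pair, H.
  rewrite e1. symmetry. apply ty_sub_comp. }
apply (@sub_ext_eq _ _ _ _ _ _ _ e2 e1).
- rewrite comp_assoc, wk_ext_map, <- comp_assoc, wk_pair. exact H.
- rewrite (var_ext_map e2 (pair_tm_ty _)). apply var_pair.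
Qed.

Lemma ext_map_eq_id Γ (A : ty Γ) (σ : sub Γ Γ) (e : A = A⟦σ⟧) :
  σ = id_sub Γ -> ext_map e = id_sub (Γ ▷ A).
Proof.
intros ->. rewrite <- (comp_id_r (ext_map e)).
assert (H : wk A ∘ (ext_map e ∘ id_sub _) = wk A ∘ id_sub _).
{ rewrite comp_assoc, wk_ext_map, comp_id_l. reflexivity. }
assert (e1 : A⟦wk A⟧ = A⟦wk A⟧⟦ext_map e ∘ id_sub _⟧).
{ rewrite <- ty_sub_comp, H, comp_id_r. reflexivity. }
assert (e2 : A⟦wk A⟧ = A⟦wk A⟧⟦id_sub _⟧) by (symmetry; apply ty_sub_id).
apply (@sub_ext_eq _ _ _ _ _ _ _ e1 e2 H), var_ext_map.
Qed.

Lemma ext_map_comp Γ Δ Θ (A : ty Γ) (B : ty Δ) (D : ty Θ) (σ : sub Δ Γ)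
    (τ : sub Θ Δ) (ρ : sub Θ Γ)
    (e : B = A⟦σ⟧) (e' : D = B⟦τ⟧) (e'' : D = A⟦ρ⟧) :
  σ ∘ τ = ρ -> ext_map e ∘ ext_map e' = ext_map e''.
Proof.
intros <-.
assert (H : wk A ∘ (ext_map e ∘ ext_map e') = wk A ∘ ext_map e'').
{ rewrite wk_ext_map, comp_assoc, wk_ext_map, <- comp_assoc, wk_ext_map.
  apply comp_assoc. }
assert (e1 : D⟦wk D⟧ = A⟦wk A⟧⟦ext_map e''⟧).
{ rewrite <- ty_sub_comp, wk_ext_map. exact (ty_sub_trans e'' eq_refl eq_refl). }
assert (e2 : D⟦wk D⟧ = A⟦wk A⟧⟦ext_map e ∘ ext_map e'⟧).
{ rewrite e1, <- !ty_sub_comp, H. reflexivity. }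
apply (@sub_ext_eq _ _ _ _ _ _ _ e2 e1 H).
assert (e3 : D⟦wk D⟧ = B⟦wk B⟧⟦ext_map e'⟧).
{ rewrite <- ty_sub_comp, wk_ext_map. exact (ty_sub_trans e' eq_refl eq_refl). }
rewrite (var_ext_map e2 e3).
assert (e4 : D⟦wk D⟧ = D⟦wk D⟧⟦id_sub _⟧) by (symmetry; apply ty_sub_id).
assert (e5 : D⟦wk D⟧ = B⟦wk B⟧⟦ext_map e' ∘ id_sub _⟧) by (rewrite comp_id_r; exact e3).
assert (e6 : D⟦wk D⟧ = A⟦wk A⟧⟦ext_map e'' ∘ id_sub _⟧) by (rewrite comp_id_r; exact e1).
rewrite (@tm_sub_eq _ _ _ _ _ _ _ e3 e5), (@tm_sub_eq _ _ _ _ _ _ _ e1 e6)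
  by (symmetry; apply comp_id_r).
rewrite (var_ext_map e5 e4), (var_ext_map e6 e4). reflexivity.
Qed.

(** Substituting in a term amounts to pulling back its section. This allows terms to be handled as
    sections from here on. *)
Lemma ext_map_sing Γ Δ (A : ty Γ) (B : ty Δ) (σ : sub Δ Γ) (e : B = A⟦σ⟧) (a : tm A) :
  ext_map e ∘ sing (tm_sub σ e a) = sing a ∘ σ.
Proof.
assert (H : wk A ∘ (ext_map e ∘ sing (tm_sub σ e a)) = wk A ∘ (sing a ∘ σ)).
{ rewrite !comp_assoc, wk_ext_map, wk_sing, <- comp_assoc, wk_sing, comp_id_l.
  apply comp_id_r. }
assert (e1 : B = A⟦wk A⟧⟦sing a ∘ σ⟧).
{ rewrite <- ty_sub_comp, comp_assoc, wk_sing, comp_id_l. exact e. }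
assert (e2 : B = A⟦wk A⟧⟦ext_map e ∘ sing (tm_sub σ e a)⟧).
{ rewrite e1 at 1. rewrite <- !ty_sub_comp, H. reflexivity. }
apply (@sub_ext_eq _ _ _ _ _ _ _ e2 e1 H).
assert (e3 : B = B⟦wk B⟧⟦sing (tm_sub σ e a)⟧).
{ rewrite <- ty_sub_comp, wk_sing. symmetry. apply ty_sub_id. }
rewrite (var_ext_map e2 e3), var_sing.
assert (e4 : A = A⟦wk A⟧⟦sing a⟧).
{ rewrite <- ty_sub_comp, wk_sing. symmetry. apply ty_sub_id. }
rewrite (tm_sub_comp e4 e e1), var_sing. reflexivity.
Qed.

Lemma sing_inj Γ (A : ty Γ) (a b : tm A) : sing a = sing b -> a = b.
Proof.
intros H.
assert (e : forall c : tm A, A = A⟦wk A⟧⟦sing c⟧).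
{ intros c. rewrite <- ty_sub_comp, wk_sing. symmetry. apply ty_sub_id. }
rewrite <- (var_sing (e a)), <- (var_sing (e b)). apply tm_sub_eq, H.
Qed.

Lemma ext_sing_inj Γ Δ (A : ty Γ) (B : ty Δ) (σ : sub Δ Γ) (e : B = A⟦σ⟧) (a b : tm B) :
  ext_map e ∘ sing a = ext_map e ∘ sing b -> a = b.
Proof.
intros H. apply sing_inj. apply (@ext_map_inj _ _ _ _ _ _ e); [|exact H].
rewrite !wk_sing. reflexivity.
Qed.

Lemma sing_ex Γ (A : ty Γ) (f : sub Γ (Γ ▷ A)) :
  wk A ∘ f = id_sub Γ -> exists a, sing a = f.
Proof.
intros H.
assert (e : A = A⟦wk A⟧⟦f⟧).
{ rewrite <- ty_sub_comp, H. symmetry. apply ty_sub_id. }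
exists (tm_sub f e (var A)).
assert (e' : A = A⟦wk A⟧⟦sing (tm_sub f e (var A))⟧).
{ rewrite <- ty_sub_comp, wk_sing. symmetry. apply ty_sub_id. }
apply (@sub_ext_eq _ _ _ _ _ _ _ e' e).
- rewrite wk_sing, H. reflexivity.
- apply var_sing.
Qed.

(** With [ext_sing_inj]: terms of [B] correspond to the lifts of [σ] through [wk A]. *)
Lemma ext_sing_ex Γ Δ (A : ty Γ) (B : ty Δ) (σ : sub Δ Γ) (e : B = A⟦σ⟧)
    (f : sub Δ (Γ ▷ A)) :
  wk A ∘ f = σ -> exists b : tm B, ext_map e ∘ sing b = f.
Proof.
intros H.
destruct (ext_map_ex e (u := id_sub Δ) (v := f)) as [w [H1 H2]].
{ rewrite comp_id_r. symmetry. exact H. }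
destruct (sing_ex H1) as [b Hb]. exists b. rewrite Hb. exact H2.
Qed.

Lemma pair_ext_map Γ Δ (A : ty Γ) (B : ty Δ) (σ : sub Δ Γ) (e : B = A⟦σ⟧)
  (a : tm A⟦σ⟧) (e' : B = A⟦σ⟧⟦id_sub Δ⟧) :
  ext_map e ∘ sing (tm_sub (id_sub Δ) e' a) = pair A σ a.
Proof.
rewrite <- lift_sing.
rewrite <- (comp_id_r (sing a)), <- (ext_map_sing e'), comp_assoc.
unfold lift. rewrite (ext_map_comp _ _ e); [reflexivity|]. apply comp_id_r.
Qed.

(** The variable, seen as a section, is the diagonal of the display map [wk A], and a projection of
    the diagonal is the identity. *)
Lemma ext_map_cast_var Γ (A : ty Γ) (A' : ty (Γ ▷ A)) (e : A' = A⟦wk A⟧)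
    (e' : A⟦wk A⟧ = A') :
  ext_map e ∘ sing (tm_cast e' (var A)) = id_sub _.
Proof.
subst A'. rewrite (tm_cast_irr _ eq_refl). simpl.
fold (lift A (wk A)). rewrite lift_sing.
assert (H : A⟦wk A ∘ id_sub _⟧ = A⟦wk A⟧⟦id_sub _⟧) by apply ty_sub_comp.
transitivity (pair A (wk A ∘ id_sub _) (tm_sub (id_sub _) H (var A))); [|apply pair_eta].
rewrite <- (comp_id_r (pair _ _ (var A))).
apply pair_comp_eq with (e := H); reflexivity.
Qed.

(** * Categorical universal properties *)

Definition is_pullback (P X A Γ : C) (p : sub P X) (q : sub P A) (f : sub X Γ)
    (g : sub A Γ) : Prop :=
  f ∘ p = g ∘ q /\
  (forall Z (u : sub Z X) (v : sub Z A), f ∘ u = g ∘ v ->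
    exists w, p ∘ w = u /\ q ∘ w = v) /\
  (forall Z (w w' : sub Z P), p ∘ w = p ∘ w' -> q ∘ w = q ∘ w' -> w = w').

(* [p : P -> Γ] is the dependent product of [b : B -> A] along [g : A -> Γ],
   with evaluation [ev] defined on the pullback [Q] of [p] along [g]. *)
Definition is_depprod (A Γ B P Q : C) (g : sub A Γ) (b : sub B A) (p : sub P Γ)
    (q1 : sub Q P) (q2 : sub Q A) (ev : sub Q B) : Prop :=
  forall X (f : sub X Γ) Y (y1 : sub Y X) (y2 : sub Y A), is_pullback y1 y2 f g ->
  (forall h : sub Y B, b ∘ h = y2 ->
    exists k, p ∘ k = f /\
      forall w, q1 ∘ w = k ∘ y1 -> q2 ∘ w = y2 -> ev ∘ w = h) /\
  (forall (k k' : sub X P) (w w' : sub Y Q), p ∘ k = f -> p ∘ k' = f ->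
    q1 ∘ w = k ∘ y1 -> q2 ∘ w = y2 -> q1 ∘ w' = k' ∘ y1 -> q2 ∘ w' = y2 ->
    ev ∘ w = ev ∘ w' -> k = k').

Lemma iso_mono Γ Δ X (i : sub Γ Δ) (f g : sub X Γ) :
  is_iso i -> i ∘ f = i ∘ g -> f = g.
Proof.
intros [j [H _]] K. rewrite <- (comp_id_l f), <- (comp_id_l g), <- H, <- !comp_assoc, K.
reflexivity.
Qed.

Lemma iso_epi Γ Δ X (i : sub Γ Δ) (f g : sub Δ X) :
  is_iso i -> f ∘ i = g ∘ i -> f = g.
Proof.
intros [j [_ H]] K. rewrite <- (comp_id_r f), <- (comp_id_r g), <- H, !comp_assoc, K.
reflexivity.
Qed.

Lemma is_iso_id Γ : is_iso (id_sub Γ).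
Proof. exists (id_sub Γ). split; apply comp_id_l. Qed.

Lemma is_iso_comp Γ Δ Θ (i : sub Δ Γ) (j : sub Θ Δ) :
  is_iso i -> is_iso j -> is_iso (i ∘ j).
Proof.
intros [i' [Hi Hi']] [j' [Hj Hj']]. exists (j' ∘ i'). split.
- rewrite <- comp_assoc, (comp_assoc i'), Hi, comp_id_l. exact Hj.
- rewrite <- comp_assoc, (comp_assoc j), Hj', comp_id_l. exact Hi'.
Qed.

Lemma is_iso_ext_map Γ Δ (A : ty Γ) (B : ty Δ) (σ : sub Δ Γ) (e : B = A⟦σ⟧) :
  is_iso σ -> is_iso (ext_map e).
Proof.
intros [τ [H1 H2]].
assert (e' : A = B⟦τ⟧).
{ rewrite e, <- ty_sub_comp, H2. symmetry. apply ty_sub_id. }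
exists (ext_map e'). split.
- rewrite (ext_map_comp e' e (ty_sub_eq_id _ H1)); [|reflexivity]. apply ext_map_eq_id, H1.
- rewrite (ext_map_comp e e' (ty_sub_eq_id _ H2)); [|reflexivity]. apply ext_map_eq_id, H2.
Qed.

Lemma is_pullback_iso (Y X A A' Γ Γ' : C) (y1 : sub Y X) (y2 : sub Y A)
    (f : sub X Γ) (g : sub A Γ) (g' : sub A' Γ') (i : sub A A') (j : sub Γ Γ') :
  is_iso i -> is_iso j -> g' ∘ i = j ∘ g -> is_pullback y1 y2 f g ->
  is_pullback y1 (i ∘ y2) (j ∘ f) g'.
Proof.
intros Hi Hj H [H1 [H2 H3]]. split; [|split].
- rewrite comp_assoc, H, <- !comp_assoc, H1. reflexivity.
- intros Z u v K. destruct (Hi) as [i' [Hi1 Hi2]].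
  destruct (H2 Z u (i' ∘ v)) as [w [Hw1 Hw2]].
  + apply (iso_mono Hj). rewrite (comp_assoc j g), <- H, <- comp_assoc, (comp_assoc i), Hi2.
    rewrite comp_id_l, <- K. apply comp_assoc.
  + exists w. split; [exact Hw1|].
    rewrite <- comp_assoc, Hw2, comp_assoc, Hi2. apply comp_id_l.
- intros Z w w' K1 K2. apply H3; [exact K1|].
  apply (iso_mono Hi). rewrite !comp_assoc. exact K2.
Qed.

(** The universal property is tested on arbitrary pullbacks, so a test pullback along [g] becomes
    one along [g'] after composition with [iA], and the answer is carried back along [iP]. *)
Lemma is_depprod_iso (Γ A B P Q A' B' P' Q' : C) (g : sub A Γ) (b : sub B A)
    (p : sub P Γ) (q1 : sub Q P) (q2 : sub Q A) (ev : sub Q B)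
    (g' : sub A' Γ) (b' : sub B' A') (p' : sub P' Γ) (q1' : sub Q' P')
    (q2' : sub Q' A') (ev' : sub Q' B')
    (iA : sub A A') (iB : sub B B') (iP : sub P P') (iQ : sub Q Q') :
  is_iso iA -> is_iso iB -> is_iso iP ->
  g' ∘ iA = g -> b' ∘ iB = iA ∘ b -> p' ∘ iP = p ->
  q1' ∘ iQ = iP ∘ q1 -> q2' ∘ iQ = iA ∘ q2 -> ev' ∘ iQ = iB ∘ ev ->
  is_pullback q1 q2 p g ->
  is_depprod g' b' p' q1' q2' ev' -> is_depprod g b p q1 q2 ev.
Proof.
intros HA HB HP Hg Hb Hp Hq1 Hq2 Hev HQ D X f Y y1 y2 HY.
assert (HY' : is_pullback y1 (iA ∘ y2) f g').
{ rewrite <- (comp_id_l f). apply is_pullback_iso with (g := g); try assumption.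
  - apply is_iso_id.
  - rewrite comp_id_l. exact Hg. }
destruct (D _ _ _ _ _ HY') as [D1 D2]. split.
- intros h Hh. destruct (D1 (iB ∘ h)) as [k' [K1 K2]].
  { rewrite comp_assoc, Hb, <- comp_assoc, Hh. reflexivity. }
  destruct (HP) as [j [J1 J2]].
  exists (j ∘ k'). split.
  + rewrite <- Hp, <- comp_assoc, (comp_assoc iP), J2, comp_id_l. exact K1.
  + intros w W1 W2. apply (iso_mono HB).
    rewrite comp_assoc, <- Hev, <- comp_assoc. apply K2.
    * rewrite comp_assoc, Hq1, <- comp_assoc, W1, !comp_assoc, J2, comp_id_l. reflexivity.
    * rewrite comp_assoc, Hq2, <- comp_assoc, W2. reflexivity.
- intros k k' w w' K K' W1 W2 W1' W2' E.
  apply (iso_mono HP). apply (D2 _ _ (iQ ∘ w) (iQ ∘ w')).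
  + rewrite comp_assoc, Hp. exact K.
  + rewrite comp_assoc, Hp. exact K'.
  + rewrite comp_assoc, Hq1, <- !comp_assoc, W1. reflexivity.
  + rewrite comp_assoc, Hq2, <- comp_assoc, W2. reflexivity.
  + rewrite comp_assoc, Hq1, <- !comp_assoc, W1'. reflexivity.
  + rewrite comp_assoc, Hq2, <- comp_assoc, W2'. reflexivity.
  + rewrite !comp_assoc, Hev, <- !comp_assoc, E. reflexivity.
Qed.

End Substitutions.

(** * Universal properties of the type formers *)

Section TypeFormers.
Variable R : RFCat.
Implicit Types Γ Δ Θ X : R.

Lemma Pi_sub_gen Γ Δ (A : ty Γ) (B : ty (Γ ▷ A)) (σ : sub Δ Γ) (A' : ty Δ)
    (B' : ty (Δ ▷ A')) (eA : A' = A⟦σ⟧) (eB : B' = B⟦ext_map eA⟧) :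
  Pi R B' = (Pi R B)⟦σ⟧.
Proof. subst A' B'. symmetry. apply Pi_sub. Qed.

Lemma lam_sub_gen Γ Δ (A : ty Γ) (B : ty (Γ ▷ A)) (σ : sub Δ Γ) (A' : ty Δ)
    (B' : ty (Δ ▷ A')) (eA : A' = A⟦σ⟧) (eB : B' = B⟦ext_map eA⟧)
    (e : Pi R B' = (Pi R B)⟦σ⟧) (b : tm B) :
  tm_sub σ e (lam R b) = lam R (tm_sub (ext_map eA) eB b).
Proof. subst A' B'. apply lam_sub. Qed.

Lemma app_sub_gen Γ Δ (A : ty Γ) (B : ty (Γ ▷ A)) (σ : sub Δ Γ) (A' : ty Δ)
    (B' : ty (Δ ▷ A')) (eA : A' = A⟦σ⟧) (eB : B' = B⟦ext_map eA⟧)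
    (e : Pi R B' = (Pi R B)⟦σ⟧) (f : tm (Pi R B)) :
  app R (tm_sub σ e f) = tm_sub (ext_map eA) eB (app R f).
Proof. rewrite <- (Pi_eta f) at 1. rewrite (lam_sub_gen eB). apply Pi_beta. Qed.

(** The generic function: every term of a substituted Π-type is an instance of it along the map that
    classifies the term. *)
Definition gen_fun Γ (A : ty Γ) (B : ty (Γ ▷ A)) : tm (Pi R B⟦lift A (wk (Pi R B))⟧) :=
  tm_cast (Pi_sub R B (wk (Pi R B))) (var (Pi R B)).

(** The counit of the dependent product, defined on the pullback of [wk (Pi R B)] along [wk A]. *)
Definition ev Γ (A : ty Γ) (B : ty (Γ ▷ A)) :
    sub (Γ ▷ Pi R B ▷ A⟦wk (Pi R B)⟧) (Γ ▷ A ▷ B) :=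
  lift B (lift A (wk (Pi R B))) ∘ sing (app R (gen_fun B)).

Lemma wk_ev Γ (A : ty Γ) (B : ty (Γ ▷ A)) : wk B ∘ ev B = lift A (wk (Pi R B)).
Proof.
unfold ev. rewrite comp_assoc, wk_lift, <- comp_assoc, wk_sing.
apply comp_id_r.
Qed.

(* Any [k : X -> Γ.Π] is a term [t] of a Π-type over [X], and [ev] after the pullback
   [k'] of [k] is [app t].  [A'] and [B'] are only equal to substituted types, so that
   no transports arise under iterated substitution. *)
Lemma ev_app Γ X (A : ty Γ) (B : ty (Γ ▷ A)) (f : sub X Γ) (k : sub X (Γ ▷ Pi R B))
    (A' : ty X) (B' : ty (X ▷ A')) (eA : A' = A⟦f⟧) (eB : B' = B⟦ext_map eA⟧)
    (e : Pi R B' = (Pi R B)⟦f⟧) (t : tm (Pi R B'))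
    (k' : sub (X ▷ A') (Γ ▷ Pi R B ▷ A⟦wk (Pi R B)⟧)) :
  ext_map e ∘ sing t = k -> wk _ ∘ k' = k ∘ wk A' -> lift A (wk _) ∘ k' = ext_map eA ->
  ev B ∘ k' = ext_map eB ∘ sing (app R t).
Proof.
intros Ht K1 K2.
assert (Hk : wk (Pi R B) ∘ k = f).
{ rewrite <- Ht, comp_assoc, wk_ext_map, <- comp_assoc, wk_sing. apply comp_id_r. }
assert (eA' : A' = A⟦wk (Pi R B)⟧⟦k⟧) by exact (ty_sub_factor eq_refl eA Hk).
assert (Hk' : k' = ext_map eA').
{ apply (@ext_map_inj _ _ _ _ _ _ _ (eq_refl A⟦wk (Pi R B)⟧)).
  - rewrite wk_ext_map. exact K1.
  - fold (lift A (wk (Pi R B))). rewrite K2. symmetry. apply ext_map_comp. exact Hk. }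
assert (HA : lift A (wk (Pi R B)) ∘ ext_map eA' = ext_map eA) by (apply ext_map_comp; exact Hk).
assert (eB' : B' = B⟦lift A (wk (Pi R B))⟧⟦ext_map eA'⟧)
  by exact (ty_sub_factor eq_refl eB HA).
assert (e' : Pi R B' = (Pi R B⟦lift A (wk (Pi R B))⟧)⟦k⟧) by exact (Pi_sub_gen eB').
assert (e0 : Pi R B⟦lift A (wk (Pi R B))⟧ = (Pi R B)⟦wk (Pi R B)⟧)
  by (symmetry; apply Pi_sub).
(* [k] classifies [t], so [t] is the instance of the generic function along [k]. Stability of [app]
   then moves the substitution outside. *)
assert (Et : t = tm_sub k e' (gen_fun B)).
{ apply (@ext_sing_inj _ _ _ _ _ _ e). rewrite Ht.
  rewrite <- (ext_map_comp e0 e' e Hk), <- comp_assoc, ext_map_sing.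
  unfold gen_fun. rewrite comp_assoc, ext_map_cast_var. symmetry. apply comp_id_l. }
rewrite Et, (app_sub_gen eB'), Hk'.
assert (EB : ext_map eB = lift B (lift A (wk (Pi R B))) ∘ ext_map eB')
  by (symmetry; apply ext_map_comp; exact HA).
rewrite EB, <- comp_assoc, ext_map_sing. unfold ev. symmetry. apply comp_assoc.
Qed.

(** [ev_app] at the identity substitution: [k'] is the pullback of the section [sing f] along
    [wk A]. It translates squares at [f] into squares at [app R f] and back. *)
Lemma sing_lift_ex Γ (A : ty Γ) (B : ty (Γ ▷ A)) (f : tm (Pi R B)) :
  exists k', wk _ ∘ k' = sing f ∘ wk A /\ lift A (wk (Pi R B)) ∘ k' = id_sub _
   /\ ev B ∘ k' = sing (app R f).
Proof.
assert (eA : A = A⟦id_sub _⟧) by (symmetry; apply ty_sub_id).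
destruct (ext_map_ex (eq_refl A⟦wk (Pi R B)⟧) (u := sing f ∘ wk A)
  (v := id_sub _)) as [k' [K1 K2]].
{ rewrite comp_assoc, wk_sing, comp_id_l, comp_id_r. reflexivity. }
exists k'. split; [exact K1|]. split; [exact K2|].
assert (HA : ext_map eA = id_sub _) by (apply ext_map_eq_id; reflexivity).
assert (eB : B = B⟦ext_map eA⟧) by (rewrite HA; symmetry; apply ty_sub_id).
assert (e : Pi R B = (Pi R B)⟦id_sub _⟧) by (symmetry; apply ty_sub_id).
rewrite (ev_app (eA := eA) eB (e := e) (t := f) (k := sing f)).
- rewrite (ext_map_eq_id _ HA). apply comp_id_l.
- rewrite (ext_map_eq_id _ eq_refl). apply comp_id_l.
- exact K1.
- rewrite HA. exact K2.
Qed.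

(** [ext_map e] classifies the generic function of [B'], so this is an instance of [ev_app]. *)
Lemma ev_natural Γ Δ (A : ty Γ) (B : ty (Γ ▷ A)) (σ : sub Δ Γ) (A' : ty Δ)
    (B' : ty (Δ ▷ A')) (eA : A' = A⟦σ⟧) (eB : B' = B⟦ext_map eA⟧)
    (e : Pi R B' = (Pi R B)⟦σ⟧)
    (k' : sub (Δ ▷ Pi R B' ▷ A'⟦wk (Pi R B')⟧) (Γ ▷ Pi R B ▷ A⟦wk (Pi R B)⟧)) :
  wk _ ∘ k' = ext_map e ∘ wk _ ->
  lift A (wk (Pi R B)) ∘ k' = ext_map eA ∘ lift A' (wk (Pi R B')) ->
  ev B ∘ k' = ext_map eB ∘ ev B'.
Proof.
intros K1 K2.
set (p := wk (Pi R B')) in *.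
assert (eA' : A'⟦p⟧ = A⟦σ ∘ p⟧) by exact (ty_sub_trans eA eq_refl eq_refl).
assert (HA : ext_map eA ∘ lift A' p = ext_map eA') by (apply ext_map_comp; reflexivity).
assert (eB' : B'⟦lift A' p⟧ = B⟦ext_map eA'⟧) by exact (ty_sub_trans eB eq_refl HA).
assert (e0 : Pi R B'⟦lift A' p⟧ = (Pi R B')⟦p⟧) by (symmetry; apply Pi_sub).
assert (e' : Pi R B'⟦lift A' p⟧ = (Pi R B)⟦σ ∘ p⟧) by exact (ty_sub_trans e e0 eq_refl).
rewrite (ev_app (eA := eA') eB' (e := e') (t := gen_fun B') (k := ext_map e)).
- unfold ev. fold p. rewrite comp_assoc. f_equal. symmetry. apply ext_map_comp. exact HA.
- rewrite <- (ext_map_comp e e0 e' eq_refl), <- comp_assoc. unfold gen_fun.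
  rewrite ext_map_cast_var. apply comp_id_r.
- exact K1.
- rewrite K2. exact HA.
Qed.

Lemma Pi_is_depprod Γ (A : ty Γ) (B : ty (Γ ▷ A)) :
  is_depprod (wk A) (wk B) (wk (Pi R B)) (wk A⟦wk (Pi R B)⟧) (lift A (wk (Pi R B))) (ev B).
Proof.
intros X f Y y1 y2 HY.
(* The test pullback [Y] is identified, by [i] and [j], with [X ▷ A⟦f⟧], over which [lam] and [app]
   are available. *)
assert (Hi : exists i, wk A⟦f⟧ ∘ i = y1 /\ lift A f ∘ i = y2).
{ apply ext_map_ex. apply HY. }
destruct Hi as [i [I1 I2]].
assert (Hj : exists j, y1 ∘ j = wk A⟦f⟧ /\ y2 ∘ j = lift A f).
{ apply HY. symmetry. apply wk_ext_map. }
destruct Hj as [j [J1 J2]].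
assert (IJ : i ∘ j = id_sub _).
{ apply (@ext_map_inj _ _ _ _ _ _ _ (eq_refl A⟦f⟧)); fold (lift A f).
  - rewrite comp_assoc, I1, comp_id_r. exact J1.
  - rewrite comp_assoc, I2, comp_id_r. exact J2. }
assert (JI : j ∘ i = id_sub _).
{ apply HY.
  - rewrite comp_assoc, J1, comp_id_r. exact I1.
  - rewrite comp_assoc, J2, comp_id_r. exact I2. }
assert (e : Pi R B⟦lift A f⟧ = (Pi R B)⟦f⟧) by (symmetry; apply Pi_sub).
(* Evaluating along [k] is applying the term that [k] classifies. Existence then follows from
   [Pi_beta], and uniqueness from [Pi_eta]. *)
assert (T : forall k (w : sub Y _) (t : tm (Pi R B⟦lift A f⟧)),
  ext_map e ∘ sing t = k -> wk A⟦wk (Pi R B)⟧ ∘ w = k ∘ y1 ->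
  lift A (wk (Pi R B)) ∘ w = y2 ->
  ev B ∘ w = lift B (lift A f) ∘ sing (app R t) ∘ i).
{ intros k w t Ht W1 W2.
  assert (E : ev B ∘ (w ∘ j) = lift B (lift A f) ∘ sing (app R t)).
  { apply (@ev_app _ _ _ _ f k _ _ (eq_refl A⟦f⟧) eq_refl e).
    - exact Ht.
    - rewrite comp_assoc, W1, <- comp_assoc, J1. reflexivity.
    - rewrite comp_assoc, W2. exact J2. }
  rewrite <- E, <- !comp_assoc, JI, comp_id_r. reflexivity. }
split.
- intros h Hh.
  destruct (@ext_sing_ex _ _ _ B B⟦lift A f⟧ _ eq_refl (h ∘ j)) as [b Hb].
  { rewrite comp_assoc, Hh. exact J2. }
  exists (ext_map e ∘ sing (lam R b)). split.
  + rewrite comp_assoc, wk_ext_map, <- comp_assoc, wk_sing. apply comp_id_r.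
  + intros w W1 W2. rewrite (T _ _ _ eq_refl W1 W2), Pi_beta.
    change (lift B (lift A f)) with (ext_map (eq_refl B⟦lift A f⟧)).
    rewrite Hb, <- comp_assoc, JI. apply comp_id_r.
- intros k k' w w' K K' W1 W2 W1' W2' E.
  destruct (ext_sing_ex e K) as [t Ht], (ext_sing_ex e K') as [t' Ht'].
  rewrite (T _ _ _ Ht W1 W2), (T _ _ _ Ht' W1' W2') in E.
  rewrite <- Ht, <- Ht'. do 2 f_equal.
  rewrite <- (Pi_eta t), <- (Pi_eta t'). f_equal.
  apply (@ext_sing_inj _ _ _ _ _ _ (eq_refl B⟦lift A f⟧)).
  apply (f_equal (fun x => x ∘ j)) in E.
  rewrite <- !comp_assoc, IJ, !comp_id_r in E. exact E.
Qed.

(** * Σ-types as iterated context extensions *)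

Lemma Sigma_sub_gen Γ Δ (A : ty Γ) (B : ty (Γ ▷ A)) (σ : sub Δ Γ) (A' : ty Δ)
    (B' : ty (Δ ▷ A')) (eA : A' = A⟦σ⟧) (eB : B' = B⟦ext_map eA⟧) :
  Sigma R B' = (Sigma R B)⟦σ⟧.
Proof. subst A' B'. symmetry. apply Sigma_sub. Qed.

Lemma spair_sub_gen Γ Δ (A : ty Γ) (B : ty (Γ ▷ A)) (σ : sub Δ Γ) (A' : ty Δ)
    (B' : ty (Δ ▷ A')) (eA : A' = A⟦σ⟧) (eB : B' = B⟦ext_map eA⟧)
    (e : Sigma R B' = (Sigma R B)⟦σ⟧) (a : tm A) (b : tm B⟦sing a⟧)
    (e' : B'⟦sing (tm_sub σ eA a)⟧ = B⟦sing a⟧⟦σ⟧) :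
  tm_sub σ e (spair R b) = spair R (tm_sub σ e' b).
Proof. subst A' B'. apply spair_sub. Qed.

(** Both projections of [t] in one section of [Γ ▷ A ▷ B]. Its type does not mention [t], whereas
    that of [snd R t] does. *)
Definition split_pair Γ (A : ty Γ) (B : ty (Γ ▷ A)) (t : tm (Sigma R B)) :
    sub Γ (Γ ▷ A ▷ B) :=
  lift B (sing (fst R t)) ∘ sing (snd R t).

Lemma wk_split_pair Γ (A : ty Γ) (B : ty (Γ ▷ A)) (t : tm (Sigma R B)) :
  wk B ∘ split_pair t = sing (fst R t).
Proof.
unfold split_pair. rewrite comp_assoc, wk_lift, <- comp_assoc, wk_sing.
apply comp_id_r.
Qed.

Lemma split_pair_spair Γ (A : ty Γ) (B : ty (Γ ▷ A)) (a : tm A) (b : tm B⟦sing a⟧) :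
  split_pair (spair R b) = lift B (sing a) ∘ sing b.
Proof.
unfold split_pair.
assert (e : B⟦sing (fst R (spair R b))⟧ = B⟦sing a⟧) by (rewrite fst_spair; reflexivity).
(* The type of [snd R (spair R b)] contains [fst R (spair R b)], so the term is abstracted before
   [fst_spair] is rewritten. *)
assert (K := snd_spair e). revert e K. generalize (snd R (spair R b)).
rewrite fst_spair. intros c e. rewrite (tm_cast_irr _ eq_refl). intros <-. reflexivity.
Qed.

Lemma split_pair_inj Γ (A : ty Γ) (B : ty (Γ ▷ A)) (t u : tm (Sigma R B)) :
  split_pair t = split_pair u -> t = u.
Proof.
intros H.
assert (K : fst R t = fst R u) by (apply sing_inj; rewrite <- !wk_split_pair, H; reflexivity).
rewrite <- (spair_eta t), <- (spair_eta u). revert H. unfold split_pair.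
generalize (snd R t) (snd R u). rewrite K. intros b c E.
rewrite (ext_sing_inj E). reflexivity.
Qed.

Lemma split_pair_ex Γ (A : ty Γ) (B : ty (Γ ▷ A)) (h : sub Γ (Γ ▷ A ▷ B)) :
  wk A ∘ (wk B ∘ h) = id_sub Γ -> exists t, split_pair t = h.
Proof.
intros H. destruct (sing_ex H) as [a Ha].
destruct (@ext_sing_ex _ _ _ B _ _ (eq_refl B⟦sing a⟧) h (eq_sym Ha)) as [b Hb].
exists (spair R b). rewrite split_pair_spair. exact Hb.
Qed.

Lemma split_pair_sub Γ Δ (A : ty Γ) (B : ty (Γ ▷ A)) (σ : sub Δ Γ) (A' : ty Δ)
    (B' : ty (Δ ▷ A')) (eA : A' = A⟦σ⟧) (eB : B' = B⟦ext_map eA⟧)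
    (e : Sigma R B' = (Sigma R B)⟦σ⟧) (t : tm (Sigma R B)) :
  ext_map eB ∘ split_pair (tm_sub σ e t) = split_pair t ∘ σ.
Proof.
unfold split_pair at 2.
rewrite <- (spair_eta t) at 1.
assert (H : ext_map eA ∘ sing (tm_sub σ eA (fst R t)) = sing (fst R t) ∘ σ)
  by apply ext_map_sing.
assert (e' : B'⟦sing (tm_sub σ eA (fst R t))⟧ = B⟦sing (fst R t)⟧⟦σ⟧).
{ apply (ty_sub_factor eq_refl (D := _) (ρ := sing (fst R t) ∘ σ)); [|reflexivity].
  exact (ty_sub_trans eB eq_refl H). }
rewrite (spair_sub_gen eB e (snd R t) e'), split_pair_spair, <- comp_assoc, <- (ext_map_sing e').
rewrite !comp_assoc. f_equal. unfold lift.
assert (e'' : B'⟦sing (tm_sub σ eA (fst R t))⟧ = B⟦sing (fst R t) ∘ σ⟧)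
  by exact (ty_sub_trans eB eq_refl H).
rewrite (ext_map_comp _ _ e'') by exact H.
symmetry. apply ext_map_comp. reflexivity.
Qed.

Definition gen_pair Γ (A : ty Γ) (B : ty (Γ ▷ A)) :
    tm (Sigma R B⟦lift A (wk (Sigma R B))⟧) :=
  tm_cast (Sigma_sub R B (wk (Sigma R B))) (var (Sigma R B)).

Definition unpair Γ (A : ty Γ) (B : ty (Γ ▷ A)) : sub (Γ ▷ Sigma R B) (Γ ▷ A ▷ B) :=
  lift B (lift A (wk (Sigma R B))) ∘
  split_pair (gen_pair B).

(** The counterpart of [ev_app]: the term classified by [k] is an instance of the generic pair, and
    splitting is stable under substitution. *)
Lemma unpair_split Γ X (A : ty Γ) (B : ty (Γ ▷ A)) (f : sub X Γ)
    (k : sub X (Γ ▷ Sigma R B)) (A' : ty X) (B' : ty (X ▷ A')) (eA : A' = A⟦f⟧)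
    (eB : B' = B⟦ext_map eA⟧) (e : Sigma R B' = (Sigma R B)⟦f⟧) (t : tm (Sigma R B')) :
  ext_map e ∘ sing t = k -> unpair B ∘ k = ext_map eB ∘ split_pair t.
Proof.
intros Ht.
assert (Hk : wk (Sigma R B) ∘ k = f).
{ rewrite <- Ht, comp_assoc, wk_ext_map, <- comp_assoc, wk_sing. apply comp_id_r. }
assert (eA' : A' = A⟦wk (Sigma R B)⟧⟦k⟧) by exact (ty_sub_factor eq_refl eA Hk).
assert (HA : lift A (wk (Sigma R B)) ∘ ext_map eA' = ext_map eA)
  by (apply ext_map_comp; exact Hk).
assert (eB' : B' = B⟦lift A (wk (Sigma R B))⟧⟦ext_map eA'⟧)
  by exact (ty_sub_factor eq_refl eB HA).
assert (e' : Sigma R B' = (Sigma R B⟦lift A (wk (Sigma R B))⟧)⟦k⟧)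
  by exact (Sigma_sub_gen eB').
set (e0 := eq_sym (Sigma_sub R B (wk (Sigma R B)))).
assert (Et : t = tm_sub k e' (gen_pair B)).
{ apply (@ext_sing_inj _ _ _ _ _ _ e). rewrite Ht.
  rewrite <- (ext_map_comp e0 e' e Hk), <- comp_assoc, ext_map_sing.
  unfold gen_pair. rewrite comp_assoc, ext_map_cast_var. symmetry. apply comp_id_l. }
unfold unpair. rewrite Et, <- comp_assoc, <- (split_pair_sub eB' e'), comp_assoc.
f_equal. apply ext_map_comp. exact HA.
Qed.

Lemma wk_unpair Γ (A : ty Γ) (B : ty (Γ ▷ A)) :
  wk A ∘ (wk B ∘ unpair B) = wk (Sigma R B).
Proof.
unfold unpair. rewrite (comp_assoc (wk B)), wk_lift.
rewrite <- (comp_assoc (lift _ _)), wk_split_pair, comp_assoc, wk_lift, <- comp_assoc, wk_sing. apply comp_id_r.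
Qed.

Lemma unpair_sing Γ (A : ty Γ) (B : ty (Γ ▷ A)) (t : tm (Sigma R B)) :
  unpair B ∘ sing t = split_pair t.
Proof.
assert (eA : A = A⟦id_sub _⟧) by (symmetry; apply ty_sub_id).
assert (HA : ext_map eA = id_sub _) by (apply ext_map_eq_id; reflexivity).
assert (eB : B = B⟦ext_map eA⟧) by (rewrite HA; symmetry; apply ty_sub_id).
assert (e : Sigma R B = (Sigma R B)⟦id_sub _⟧) by (symmetry; apply ty_sub_id).
rewrite (unpair_split (eA := eA) eB (e := e) (t := t) (k := sing t)).
- rewrite (ext_map_eq_id _ HA). apply comp_id_l.
- rewrite (ext_map_eq_id _ eq_refl). apply comp_id_l.
Qed.

Lemma unpair_natural Γ Δ (A : ty Γ) (B : ty (Γ ▷ A)) (σ : sub Δ Γ) (A' : ty Δ)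
    (B' : ty (Δ ▷ A')) (eA : A' = A⟦σ⟧) (eB : B' = B⟦ext_map eA⟧)
    (e : Sigma R B' = (Sigma R B)⟦σ⟧) :
  unpair B ∘ ext_map e = ext_map eB ∘ unpair B'.
Proof.
set (p := wk (Sigma R B')).
assert (eA' : A'⟦p⟧ = A⟦σ ∘ p⟧) by exact (ty_sub_trans eA eq_refl eq_refl).
assert (HA : ext_map eA ∘ lift A' p = ext_map eA') by (apply ext_map_comp; reflexivity).
assert (eB' : B'⟦lift A' p⟧ = B⟦ext_map eA'⟧) by exact (ty_sub_trans eB eq_refl HA).
assert (e0 : Sigma R B'⟦lift A' p⟧ = (Sigma R B')⟦p⟧) by (symmetry; apply Sigma_sub).
assert (e' : Sigma R B'⟦lift A' p⟧ = (Sigma R B)⟦σ ∘ p⟧) by exact (ty_sub_trans e e0 eq_refl).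
rewrite (unpair_split (eA := eA') eB' (e := e') (t := gen_pair B') (k := ext_map e)).
- unfold unpair. fold p. rewrite comp_assoc. f_equal. symmetry. apply ext_map_comp. exact HA.
- rewrite <- (ext_map_comp e e0 e' eq_refl), <- comp_assoc. unfold gen_pair.
  rewrite ext_map_cast_var. apply comp_id_r.
Qed.

Lemma unpair_is_iso Γ (A : ty Γ) (B : ty (Γ ▷ A)) : is_iso (unpair B).
Proof.
(* By Yoneda it suffices that [unpair B] is bijective on generalized elements. [unpair_split]
   reduces this to the correspondence between Σ-terms and sections. *)
assert (Inj : forall X (k k' : sub X (Γ ▷ Sigma R B)), unpair B ∘ k = unpair B ∘ k' -> k = k').
{ intros X k k' E.
  set (f := wk (Sigma R B) ∘ k).
  assert (Hf : wk (Sigma R B) ∘ k' = f).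
  { unfold f. rewrite <- wk_unpair, <- !comp_assoc, E. reflexivity. }
  set (e := eq_sym (Sigma_sub R B f)).
  destruct (ext_sing_ex e (f := k) eq_refl) as [t Ht], (ext_sing_ex e Hf) as [t' Ht'].
  rewrite (unpair_split (eA := eq_refl A⟦f⟧) eq_refl Ht) in E.
  rewrite (unpair_split (eA := eq_refl A⟦f⟧) eq_refl Ht') in E.
  rewrite <- Ht, <- Ht'. do 2 f_equal. apply split_pair_inj.
  apply (ext_map_inj (e := eq_refl B⟦lift A f⟧)); [|exact E].
  rewrite !wk_split_pair.
  apply (ext_map_inj (e := eq_refl A⟦f⟧)); [rewrite !wk_sing; reflexivity|].
  apply (f_equal (fun x => wk B ∘ x)) in E.
  rewrite !comp_assoc, !wk_ext_map, <- !comp_assoc, !wk_split_pair in E. exact E. }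
assert (Sur : forall X (h : sub X (Γ ▷ A ▷ B)), exists k, unpair B ∘ k = h).
{ intros X h. set (f := wk A ∘ (wk B ∘ h)).
  destruct (ext_map_ex (eq_refl A⟦f⟧) (u := id_sub X) (v := wk B ∘ h)) as [a [Ha Ha']].
  { rewrite comp_id_r. reflexivity. }
  destruct (ext_map_ex (eq_refl B⟦lift A f⟧) (u := a) (v := h) Ha') as [b [Hb Hb']].
  destruct (@split_pair_ex _ _ _ b) as [t Ht]; [rewrite Hb; exact Ha|].
  exists (ext_map (eq_sym (Sigma_sub R B f)) ∘ sing t).
  transitivity (lift B (lift A f) ∘ split_pair t).
  - apply (unpair_split (eA := eq_refl A⟦f⟧) eq_refl eq_refl).
  - rewrite Ht. exact Hb'. }
destruct (Sur _ (id_sub _)) as [p Hp]. exists p. split; [|exact Hp].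
apply Inj. rewrite comp_assoc, Hp, comp_id_l, comp_id_r. reflexivity.
Qed.

(** * Equality types as equalizers, and unit types *)

Lemma wk_Eq_mono Γ (A : ty Γ) (a b : tm A) X (k k' : sub X (Γ ▷ Eq R a b)) :
  wk (Eq R a b) ∘ k = wk (Eq R a b) ∘ k' -> k = k'.
Proof.
intros H.
set (f := wk (Eq R a b) ∘ k).
destruct (ext_sing_ex (eq_sym (Eq_sub R a b f)) (f := k) eq_refl) as [t Ht].
destruct (ext_sing_ex (eq_sym (Eq_sub R a b f)) (f := k') (eq_sym H)) as [t' Ht'].
rewrite <- Ht, <- Ht', (Eq_unique t t'). reflexivity.
Qed.

Lemma wk_Eq_equalizes Γ (A : ty Γ) (a b : tm A) :
  sing a ∘ wk (Eq R a b) = sing b ∘ wk (Eq R a b).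
Proof.
assert (H := Eq_reflection (tm_cast (Eq_sub R a b (wk _)) (var (Eq R a b)))).
rewrite <- (ext_map_sing eq_refl a), <- (ext_map_sing eq_refl b), H. reflexivity.
Qed.

(** With the two preceding lemmas, [wk (Eq R a b)] is the equalizer of [sing a] and [sing b]: [refl]
    gives the factorization, equality reflection the equalizing property, and uniqueness of proofs
    the monomorphism. *)
Lemma Eq_ex Γ (A : ty Γ) (a b : tm A) X (f : sub X Γ) :
  sing a ∘ f = sing b ∘ f -> exists k, wk (Eq R a b) ∘ k = f.
Proof.
intros H.
assert (K : tm_sub f eq_refl a = tm_sub f eq_refl b).
{ apply (@ext_sing_inj _ _ _ _ _ _ (eq_refl A⟦f⟧)). rewrite !ext_map_sing. exact H. }
assert (e : Eq R (tm_sub f eq_refl a) (tm_sub f eq_refl a) = (Eq R a b)⟦f⟧).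
{ rewrite Eq_sub, K. reflexivity. }
exists (ext_map e ∘ sing (refl R _)).
rewrite comp_assoc, wk_ext_map, <- comp_assoc, wk_sing. apply comp_id_r.
Qed.

Lemma wk_Unit_iso Γ : is_iso (wk (Unit R Γ)).
Proof.
exists (sing (star R Γ)). split; [|apply wk_sing].
assert (H : forall X (k k' : sub X (Γ ▷ Unit R Γ)), wk _ ∘ k = wk _ ∘ k' -> k = k').
{ intros X k k' K. set (f := wk (Unit R Γ) ∘ k).
  destruct (ext_sing_ex (eq_sym (Unit_sub R f)) (f := k) eq_refl) as [t Ht].
  destruct (ext_sing_ex (eq_sym (Unit_sub R f)) (f := k') (eq_sym K)) as [t' Ht'].
  rewrite <- Ht, <- Ht', (Unit_eta t), (Unit_eta t'). reflexivity. }
apply H. rewrite comp_assoc, wk_sing, comp_id_l, comp_id_r. reflexivity.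
Qed.

End TypeFormers.

(** * Preservation by weak RF-morphisms *)

Section CwFMorphism.
Variables (C D : CwF) (F : CwFMor C D).
Implicit Types Γ Δ : C.

Lemma wk_ext_cmp Γ (A : ty Γ) : wk (on_ty F A) ∘ ext_cmp F A = on_sub F (wk A).
Proof. apply wk_pair. Qed.

Lemma ext_cmp_iso Γ (A : ty Γ) : is_iso (ext_cmp F A).
Proof. exists (ext_inv F A). split; [apply ext_inv_l|apply ext_inv_r]. Qed.

Lemma on_wk_ext_inv Γ (A : ty Γ) : on_sub F (wk A) ∘ ext_inv F A = wk (on_ty F A).
Proof. rewrite <- wk_ext_cmp, <- comp_assoc, ext_inv_r. apply comp_id_r. Qed.

Lemma ext_cmp_sing Γ (A : ty Γ) (a : tm A) :
  ext_cmp F A ∘ on_sub F (sing a) = sing (on_tm F a).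
Proof.
assert (e : on_ty F A = (on_ty F A)⟦on_sub F (id_sub Γ)⟧)
  by (apply ty_sub_eq_id, on_id).
assert (e' : on_ty F A = (on_ty F A⟦id_sub Γ⟧)⟦id_sub (F Γ)⟧).
{ rewrite ty_sub_id. rewrite on_ty_sub. exact e. }
unfold sing at 1. rewrite ext_cmp_pair.
assert (e2 : on_ty F A = (on_ty F A)⟦on_sub F (id_sub Γ)⟧⟦id_sub (F Γ)⟧).
{ rewrite ty_sub_id. exact e. }
rewrite <- (pair_ext_map e _ e2).
rewrite (ext_map_eq_id e (on_id _ _)), comp_id_l. f_equal.
assert (e3 : on_ty F A⟦id_sub Γ⟧ = (on_ty F A)⟦on_sub F (id_sub Γ)⟧) by apply on_ty_sub.
rewrite (on_tm_sub eq_refl e3), (cast_tm_sub _ e3 eq_refl).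
rewrite <- (tm_sub_comp eq_refl e2 (eq_trans e (f_equal _ (eq_sym (comp_id_r _))))).
assert (e4 : on_ty F A = (on_ty F A)⟦id_sub (F Γ)⟧) by (symmetry; apply ty_sub_id).
rewrite (@tm_sub_eq _ _ _ _ _ _ _ _ e4); [apply tm_sub_id|].
rewrite comp_id_r. apply on_id.
Qed.

Lemma ext_cmp_lift Γ Δ (A : ty Γ) (σ : sub Δ Γ) :
  ext_cmp F A ∘ on_sub F (lift A σ) = ext_map (on_ty_sub F A σ) ∘ ext_cmp F A⟦σ⟧.
Proof. apply ext_cmp_ext_map. Qed.

(** The invertible comparisons [ext_cmp] identify the image of the square with the pullback square
    of [ext_map e'] in [D]. *)
Lemma on_ext_map_pullback Γ Δ (A : ty Γ) (B : ty Δ) (σ : sub Δ Γ) (e : B = A⟦σ⟧) :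
  is_pullback (on_sub F (wk B)) (on_sub F (ext_map e)) (on_sub F σ) (on_sub F (wk A)).
Proof.
assert (e' : on_ty F B = (on_ty F A)⟦on_sub F σ⟧) by (rewrite e; apply on_ty_sub).
split; [|split].
- rewrite <- !on_comp, wk_ext_map. reflexivity.
- intros Z u v H.
  destruct (ext_map_ex e' (u := u) (v := ext_cmp F A ∘ v)) as [w [W1 W2]].
  { rewrite comp_assoc, wk_ext_cmp. exact H. }
  exists (ext_inv F B ∘ w). split.
  + rewrite comp_assoc, on_wk_ext_inv. exact W1.
  + apply (iso_mono (ext_cmp_iso A)).
    rewrite comp_assoc, (ext_cmp_ext_map e e'), <- comp_assoc, (comp_assoc (ext_cmp F B)).
    rewrite ext_inv_r, comp_id_l. exact W2.
- intros Z w w' H K. apply (iso_mono (ext_cmp_iso B)).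
  apply (ext_map_inj (e := e')).
  + rewrite !comp_assoc, wk_ext_cmp. exact H.
  + rewrite !(comp_assoc (ext_map e')), <- !(ext_cmp_ext_map e e'), <- !comp_assoc, K.
    reflexivity.
Qed.

End CwFMorphism.

Section WeakMorphism.
Variables (R S : RFCat) (F : WeakRFMor R S).
Implicit Types Γ Δ : R.

(** The comparisons [ext_cmp] and [Pi_cmp] identify the image of [ev B] with the evaluation of
    [on_fam F B] in [S], so [Pi_is_depprod] in [S] transfers along [is_depprod_iso]. *)
Lemma on_ev_depprod Γ (A : ty Γ) (B : ty (Γ ▷ A)) :
  is_depprod (on_sub F (wk A)) (on_sub F (wk B)) (on_sub F (wk (Pi R B)))
    (on_sub F (wk A⟦wk (Pi R B)⟧)) (on_sub F (lift A (wk (Pi R B)))) (on_sub F (ev B)).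
Proof.
assert (eB : on_ty F B = (on_fam F B)⟦ext_cmp F A⟧).
{ unfold on_fam. rewrite <- ty_sub_comp, ext_inv_l, ty_sub_id. reflexivity. }
assert (HPi : is_iso (Pi_cmp F B)) by apply weak_Pi.
assert (Hwk : wk (Pi S (on_fam F B)) ∘ Pi_cmp F B = on_sub F (wk (Pi R B))) by apply wk_pair.
(* The identification of the domains of evaluation is [q ∘ r]: [r] inverts [ext_inv_sub], and [q],
   constructed below, is the pullback of [Pi_cmp F B]. *)
assert (Hr : exists r, ext_inv_sub F A (wk (Pi R B)) ∘ r = id_sub (F (Γ ▷ Pi R B ▷ A⟦wk (Pi R B)⟧)) /\
  wk (on_ty F A)⟦on_sub F (wk (Pi R B))⟧ ∘ r = on_sub F (wk A⟦wk (Pi R B)⟧)).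
{ assert (I : is_iso (ext_inv_sub F A (wk (Pi R B)))).
  { apply is_iso_comp.
    - exists (ext_cmp F A⟦wk (Pi R B)⟧). split; [apply ext_inv_r|apply ext_inv_l].
    - apply is_iso_ext_map, is_iso_id. }
  destruct I as [r [R1 R2]]. exists r. split; [exact R2|].
  apply (@iso_epi _ _ _ _ (ext_inv_sub F A (wk (Pi R B)))).
  - exists r. split; assumption.
  - rewrite <- comp_assoc, R1, comp_id_r. unfold ext_inv_sub.
    rewrite comp_assoc, on_wk_ext_inv, wk_ext_map. symmetry. apply comp_id_l. }
destruct Hr as [r [R1 R2]].
assert (Hl : ext_cmp F A ∘ on_sub F (lift A (wk (Pi R B))) ∘ ext_inv_sub F A (wk (Pi R B))
  = lift (on_ty F A) (on_sub F (wk (Pi R B)))).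
{ unfold ext_inv_sub. rewrite (ext_cmp_lift F A), <- comp_assoc.
  rewrite (comp_assoc (ext_cmp F A⟦wk (Pi R B)⟧)), ext_inv_r, comp_id_l. apply ext_map_comp_id. }
destruct (ext_map_ex (eq_refl (on_ty F A)⟦wk (Pi S (on_fam F B))⟧)
  (u := Pi_cmp F B ∘ wk (on_ty F A)⟦on_sub F (wk (Pi R B))⟧)
  (v := lift (on_ty F A) (on_sub F (wk (Pi R B))))) as [q [Q1 Q2]].
{ rewrite wk_lift, (comp_assoc (wk (Pi S (on_fam F B)))), Hwk. reflexivity. }
fold (lift (on_ty F A) (wk (Pi S (on_fam F B)))) in Q2.
apply (@is_depprod_iso _ _ _ _ _ _ _ _ _ _ _ _ _ _ _ _ (wk (on_ty F A)) (wk (on_fam F B)) (wk (Pi S (on_fam F B)))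
  (wk (on_ty F A)⟦wk (Pi S (on_fam F B))⟧) (lift (on_ty F A) (wk (Pi S (on_fam F B)))) (ev (on_fam F B))
  (ext_cmp F A) (ext_map eB ∘ ext_cmp F B) (Pi_cmp F B) (q ∘ r)).
- apply ext_cmp_iso.
- apply is_iso_comp; [apply is_iso_ext_map, ext_cmp_iso|apply ext_cmp_iso].
- exact HPi.
- apply wk_ext_cmp.
- rewrite comp_assoc, wk_ext_map, <- comp_assoc, wk_ext_cmp. reflexivity.
- exact Hwk.
- rewrite comp_assoc, Q1, <- comp_assoc, R2. reflexivity.
- rewrite comp_assoc. rewrite Q2, <- Hl, <- comp_assoc, R1.
  apply comp_id_r.
- rewrite comp_assoc.
  (* By its definition through [on_Pi], [Pi_cmp F B] classifies the abstraction of the image of the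
     generic application. Evaluating it gives that image back by [Pi_beta], and this is
     [on_sub F (ev B)] up to the comparisons. *)
  rewrite (ev_app (eA := eq_refl (on_ty F A)⟦on_sub F (wk (Pi R B))⟧) eq_refl
    (e := eq_sym (Pi_sub S (on_fam F B) (on_sub F (wk (Pi R B)))))
    (t := lam S (tm_sub (ext_inv_sub F A (wk (Pi R B))) (on_fam_lift F B (wk (Pi R B)))
      (on_tm F (app R (gen_fun B))))) (k := Pi_cmp F B)).
  + rewrite Pi_beta.
    change (ext_map (eq_refl (on_fam F B)⟦ext_map (eq_refl (on_ty F A)⟦on_sub F (wk (Pi R B))⟧)⟧))
      with (lift (on_fam F B) (lift (on_ty F A) (on_sub F (wk (Pi R B))))).
    set (s := ext_inv_sub F A (wk (Pi R B))) in *. set (b := app R (gen_fun B)).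
    assert (e1 : on_ty F B⟦lift A (wk (Pi R B))⟧ = (on_fam F B)⟦ext_cmp F A ∘ on_sub F (lift A (wk (Pi R B)))⟧).
    { rewrite on_ty_sub, eB. symmetry. apply ty_sub_comp. }
    transitivity (ext_map e1 ∘ sing (on_tm F b)).
    * rewrite <- (comp_id_r (sing (on_tm F b))), <- R1, (comp_assoc _ s).
      rewrite <- (ext_map_sing (on_fam_lift F B (wk (Pi R B)))), !comp_assoc.
      do 2 f_equal. symmetry. apply ext_map_comp. exact Hl.
    * unfold ev. fold b.
      rewrite on_comp, <- ext_cmp_sing, comp_assoc, <- !(comp_assoc (ext_map eB)).
      rewrite (comp_assoc (ext_cmp F B)).
      rewrite (ext_cmp_lift F B).
      rewrite !comp_assoc. do 2 f_equal. symmetry. apply ext_map_comp. reflexivity.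
  + unfold Pi_cmp.
    assert (e0 : Pi S (on_fam F B)⟦lift (on_ty F A) (on_sub F (wk (Pi R B)))⟧ = (Pi S (on_fam F B))⟦on_sub F (wk (Pi R B))⟧⟦id_sub _⟧).
    { rewrite ty_sub_id, Pi_sub. reflexivity. }
    rewrite <- (pair_ext_map (eq_sym (Pi_sub S (on_fam F B) (on_sub F (wk (Pi R B))))) _ e0). f_equal. f_equal. unfold on_Pi.
    rewrite (tm_sub_cast _ _ (eq_sym (ty_sub_id _))).
    symmetry. apply tm_sub_id.
  + exact Q1.
  + exact Q2.
- apply on_ext_map_pullback.
- apply Pi_is_depprod.
Qed.

Lemma wk_Eq_cmp Γ (A : ty Γ) (a b : tm A) :
  wk (Eq S (on_tm F a) (on_tm F b)) ∘ Eq_cmp F a b = on_sub F (wk (Eq R a b)).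
Proof. apply wk_pair. Qed.

Lemma on_wk_Eq_mono Γ (A : ty Γ) (a b : tm A) X (k k' : sub X (F (Γ ▷ Eq R a b))) :
  on_sub F (wk (Eq R a b)) ∘ k = on_sub F (wk (Eq R a b)) ∘ k' -> k = k'.
Proof.
intros H. apply (iso_mono (weak_Eq F a b)). apply wk_Eq_mono.
rewrite !comp_assoc, wk_Eq_cmp. exact H.
Qed.

Lemma on_Eq_ex Γ (A : ty Γ) (a b : tm A) X (f : sub X (F Γ)) :
  on_sub F (sing a) ∘ f = on_sub F (sing b) ∘ f ->
  exists k, on_sub F (wk (Eq R a b)) ∘ k = f.
Proof.
intros H. destruct (@Eq_ex S _ _ (on_tm F a) (on_tm F b) _ f) as [k Hk].
{ rewrite <- !ext_cmp_sing, <- !comp_assoc, H. reflexivity. }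
destruct (weak_Eq F a b) as [j [_ J]]. exists (j ∘ k).
rewrite <- wk_Eq_cmp, <- comp_assoc, (comp_assoc (Eq_cmp F a b)), J, comp_id_l. exact Hk.
Qed.

End WeakMorphism.

(** * Naturality squares *)

Definition square (C D : CwF) (F G : CwFMor C D) (Γ Δ : C) (σ : sub Δ Γ)
    (δ : sub (F Δ) (G Δ)) (φ : sub (F Γ) (G Γ)) : Prop :=
  φ ∘ on_sub F σ = on_sub G σ ∘ δ.

Section Squares.
Variables (C D : CwF).
Implicit Types (F G H : CwFMor C D) (Γ Δ Θ : C).

Lemma square_id F G Γ (φ : sub (F Γ) (G Γ)) : square (id_sub Γ) φ φ.
Proof. unfold square. rewrite !on_id, comp_id_l. apply comp_id_r. Qed.

Lemma square_eq_id F G Γ (σ : sub Γ Γ) (φ : sub (F Γ) (G Γ)) :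
  σ = id_sub Γ -> square σ φ φ.
Proof. intros ->. apply square_id. Qed.

Lemma square_refl F Γ Δ (σ : sub Δ Γ) :
  square (F := F) (G := F) σ (id_sub _) (id_sub _).
Proof. unfold square. rewrite comp_id_l. symmetry. apply comp_id_r. Qed.

Lemma square_comp F G Γ Δ Θ (σ : sub Δ Γ) (τ : sub Θ Δ) (φ : sub (F Γ) (G Γ))
    (δ : sub (F Δ) (G Δ)) (θ : sub (F Θ) (G Θ)) :
  square σ δ φ -> square τ θ δ -> square (σ ∘ τ) θ φ.
Proof.
unfold square. intros K L.
rewrite !on_comp, comp_assoc, K, <- comp_assoc, L. apply comp_assoc.
Qed.

Lemma square_paste F G H Γ Δ (σ : sub Δ Γ) (φ : sub (F Γ) (G Γ)) (δ : sub (F Δ) (G Δ))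
    (φ' : sub (G Γ) (H Γ)) (δ' : sub (G Δ) (H Δ)) :
  square σ δ φ -> square σ δ' φ' -> square σ (δ' ∘ δ) (φ' ∘ φ).
Proof.
unfold square. intros K L. rewrite <- comp_assoc, K, comp_assoc, L. symmetry. apply comp_assoc.
Qed.

Lemma square_inv F G Γ Δ (σ : sub Δ Γ) (φ : sub (F Γ) (G Γ)) (δ : sub (F Δ) (G Δ))
    (φ' : sub (G Γ) (F Γ)) (δ' : sub (G Δ) (F Δ)) :
  φ' ∘ φ = id_sub _ -> δ ∘ δ' = id_sub _ -> square σ δ φ -> square σ δ' φ'.
Proof.
unfold square. intros K L E.
rewrite <- (comp_id_r (on_sub G σ)), <- L, (comp_assoc (on_sub G σ)), <- E, !comp_assoc.
rewrite K, comp_id_l. reflexivity.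
Qed.

Section Cartesian.
Variables (F G : CwFMor C D) (Γ Δ : C) (A : ty Γ) (B : ty Δ) (σ : sub Δ Γ) (e : B = A⟦σ⟧).
Variables (φ : sub (F Γ) (G Γ)) (δ : sub (F Δ) (G Δ)) (α : sub (F (Γ ▷ A)) (G (Γ ▷ A))).
Hypothesis (Hσ : square σ δ φ) (HA : square (wk A) α φ).

(** [G] preserves the pullback of display maps. The map [β] obtained here is the component of a
    substituted type, and its uniqueness, proved next, makes substitution strictly functorial. *)
Lemma cartesian_square_ex :
  exists β : sub (F (Δ ▷ B)) (G (Δ ▷ B)), square (wk B) β δ /\ square (ext_map e) β α.
Proof.
destruct (on_ext_map_pullback G e) as [_ [H _]].
destruct (H _ (δ ∘ on_sub F (wk B)) (α ∘ on_sub F (ext_map e))) as [β [H1 H2]].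
{ rewrite !comp_assoc, <- Hσ, <- HA, <- !comp_assoc, <- !on_comp, wk_ext_map. reflexivity. }
exists β. split; symmetry; assumption.
Qed.

Lemma cartesian_square_unique (β β' : sub (F (Δ ▷ B)) (G (Δ ▷ B))) :
  square (wk B) β δ -> square (ext_map e) β α ->
  square (wk B) β' δ -> square (ext_map e) β' α -> β = β'.
Proof.
unfold square. intros H1 H2 H1' H2'. apply (on_ext_map_pullback G e).
- rewrite <- H1. exact H1'.
- rewrite <- H2. exact H2'.
Qed.

(** Naturality of a map into [Δ ▷ B] may be tested after the two pullback projections. *)
Lemma square_cartesian (β : sub (F (Δ ▷ B)) (G (Δ ▷ B))) Θ (θ : sub (F Θ) (G Θ))
    (k : sub Θ (Δ ▷ B)) :
  square (wk B) β δ -> square (ext_map e) β α ->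
  square (wk B ∘ k) θ δ -> square (ext_map e ∘ k) θ α -> square k θ β.
Proof.
unfold square. intros H1 H2 K1 K2. rewrite on_comp in K1, K2.
apply (on_ext_map_pullback G e).
- rewrite !comp_assoc, <- H1, <- comp_assoc, K1, on_comp. reflexivity.
- rewrite !comp_assoc, <- H2, <- comp_assoc, K2, on_comp. reflexivity.
Qed.

End Cartesian.

Lemma cartesian_square_iso F G Γ Δ (A : ty Γ) (B : ty Δ) (σ : sub Δ Γ) (e : B = A⟦σ⟧)
    (φ : sub (F Γ) (G Γ)) (δ : sub (F Δ) (G Δ)) (α : sub (F (Γ ▷ A)) (G (Γ ▷ A))) :
  is_iso φ -> is_iso δ -> is_iso α -> square σ δ φ -> square (wk A) α φ ->
  exists β : sub (F (Δ ▷ B)) (G (Δ ▷ B)),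
    is_iso β /\ square (wk B) β δ /\ square (ext_map e) β α.
Proof.
intros [φ' [Hφ Hφ']] [δ' [Hδ Hδ']] [α' [Hα Hα']] Hσ HA.
destruct (cartesian_square_ex e Hσ HA) as [β [H1 H2]].
destruct (cartesian_square_ex e (square_inv Hφ Hδ' Hσ) (square_inv Hφ Hα' HA))
  as [β' [H1' H2']].
exists β. split; [|split; assumption].
exists β'. split.
(* [β'] is built from the inverse components. Both composites fill the same squares as identities,
   hence are identities. *)
- apply (@cartesian_square_unique F F _ _ _ _ _ e (id_sub _) (id_sub _)).
  + rewrite <- Hδ. exact (square_paste H1 H1').
  + rewrite <- Hα. exact (square_paste H2 H2').
  + apply square_refl.
  + apply square_refl.
- apply (@cartesian_square_unique G G _ _ _ _ _ e (id_sub _) (id_sub _)).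
  + rewrite <- Hδ'. exact (square_paste H1' H1).
  + rewrite <- Hα'. exact (square_paste H2' H2).
  + apply square_refl.
  + apply square_refl.
Qed.

End Squares.

(** * Components at the type formers *)

Section TypeFormerSquares.
Variables (R S : RFCat).
Implicit Types (F G H : WeakRFMor R S) (Γ Δ Θ : R).

Section Pi.
Variables (Γ : R) (A : ty Γ) (B : ty (Γ ▷ A)).

(* The contravariance in [A] is absorbed by the pullback [π'] of [π], so that the
   relation composes. *)
Definition Pi_square F G (φ : sub (F Γ) (G Γ)) (α : sub (F (Γ ▷ A)) (G (Γ ▷ A)))
    (β : sub (F (Γ ▷ A ▷ B)) (G (Γ ▷ A ▷ B)))
    (π : sub (F (Γ ▷ Pi R B)) (G (Γ ▷ Pi R B))) : Prop :=
  square (wk (Pi R B)) π φ /\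
  exists π', square (wk A⟦wk (Pi R B)⟧) π' π /\ square (lift A (wk (Pi R B))) π' α /\
    square (ev B) π' β.

(** Invertibility of [φ] and [α] makes [F (Δ ▷ A')] a pullback along [on_sub G (wk A)], so the
    dependent product in the image of [G] can be tested on it. *)
Lemma test_pullback F G Δ (A' : ty Δ) (σ : sub Δ Γ) (e : A' = A⟦σ⟧)
    (φ : sub (F Γ) (G Γ)) (α : sub (F (Γ ▷ A)) (G (Γ ▷ A))) :
  is_iso φ -> is_iso α -> square (wk A) α φ ->
  is_pullback (on_sub F (wk A')) (α ∘ on_sub F (ext_map e)) (φ ∘ on_sub F σ) (on_sub G (wk A)).
Proof.
intros Hφ Hα HA. apply is_pullback_iso with (g := on_sub F (wk A)); try assumption.
- symmetry. exact HA.
- apply on_ext_map_pullback.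
Qed.

Lemma Pi_square_ex F G (φ : sub (F Γ) (G Γ)) (α : sub (F (Γ ▷ A)) (G (Γ ▷ A)))
    (β : sub (F (Γ ▷ A ▷ B)) (G (Γ ▷ A ▷ B))) :
  is_iso φ -> is_iso α -> square (wk A) α φ -> square (wk B) β α ->
  exists π, Pi_square φ α β π.
Proof.
intros Hφ Hα HA HB.
destruct (@on_ev_depprod R S G _ _ B _ _ _ _ _
  (test_pullback (eq_refl A⟦wk (Pi R B)⟧) Hφ Hα HA)) as [E _].
(* [π] is the transpose of [β ∘ on_sub F (ev B)] for the dependent product preserved by [G]. *)
destruct (E (β ∘ on_sub F (ev B))) as [π [H1 H2]].
{ rewrite comp_assoc, <- HB, <- comp_assoc, <- on_comp, wk_ev. reflexivity. }
exists π. split; [symmetry; exact H1|].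
destruct (@cartesian_square_ex _ _ F G _ _ _ _ _ (eq_refl A⟦wk (Pi R B)⟧) φ π α)
  as [π' [K1 K2]]; [symmetry; exact H1|exact HA|].
exists π'. split; [exact K1|]. split; [exact K2|].
symmetry. apply H2; symmetry; assumption.
Qed.

Lemma square_into_Pi F G (φ : sub (F Γ) (G Γ)) (α : sub (F (Γ ▷ A)) (G (Γ ▷ A)))
    (β : sub (F (Γ ▷ A ▷ B)) (G (Γ ▷ A ▷ B))) (π : sub (F (Γ ▷ Pi R B)) (G (Γ ▷ Pi R B)))
    Θ (θ : sub (F Θ) (G Θ)) (k : sub Θ (Γ ▷ Pi R B)) (σ : sub Θ Γ) (A' : ty Θ)
    (e : A' = A⟦σ⟧) (α' : sub (F (Θ ▷ A')) (G (Θ ▷ A')))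
    (k' : sub (Θ ▷ A') (Γ ▷ Pi R B ▷ A⟦wk (Pi R B)⟧)) :
  is_iso φ -> is_iso α -> square (wk A) α φ -> Pi_square φ α β π ->
  wk _ ∘ k = σ -> square σ θ φ -> square (wk A') α' θ -> square (ext_map e) α' α ->
  wk _ ∘ k' = k ∘ wk A' -> lift A _ ∘ k' = ext_map e ->
  square (ev B ∘ k') α' β -> square k θ π.
Proof.
intros Hφ Hα HA [P1 [π' [P2 [P3 P4]]]] Hk Hσ HA' He K1 K2 Hev.
destruct (@on_ev_depprod R S G _ _ B _ _ _ _ _ (test_pullback e Hφ Hα HA)) as [_ E].
(* The two sides of the square are maps into a dependent product. These are their pullbacks, after
   which [on_sub G (ev B)] must agree. *)
apply (E _ _ (π' ∘ on_sub F k') (on_sub G k' ∘ α')).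
- rewrite comp_assoc, <- P1, <- comp_assoc, <- on_comp, Hk. reflexivity.
- rewrite comp_assoc, <- on_comp, Hk. symmetry. exact Hσ.
- rewrite comp_assoc, <- P2, <- !comp_assoc, <- !on_comp, K1. reflexivity.
- rewrite comp_assoc, <- P3, <- !comp_assoc, <- !on_comp, K2. reflexivity.
- rewrite comp_assoc, <- on_comp, K1, on_comp, <- !comp_assoc, HA'. reflexivity.
- rewrite comp_assoc, <- on_comp, K2. symmetry. exact He.
- rewrite !comp_assoc, <- P4, <- on_comp, <- comp_assoc, <- on_comp. exact Hev.
Qed.

Lemma Pi_square_unique F G (φ : sub (F Γ) (G Γ)) (α : sub (F (Γ ▷ A)) (G (Γ ▷ A)))
    (β : sub (F (Γ ▷ A ▷ B)) (G (Γ ▷ A ▷ B))) (π ρ : sub (F (Γ ▷ Pi R B)) (G (Γ ▷ Pi R B))) :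
  is_iso φ -> is_iso α -> square (wk A) α φ ->
  Pi_square φ α β π -> Pi_square φ α β ρ -> π = ρ.
Proof.
intros Hφ Hα HA HP [Q1 [ρ' [Q2 [Q3 Q4]]]].
(* Uniqueness is naturality of the identity map, with [ρ] on the source and [π] on the target. *)
assert (H : square (id_sub _) ρ π).
{ apply (@square_into_Pi F G φ α β π _ ρ (id_sub _) (wk (Pi R B)) _ eq_refl ρ' (id_sub _));
    try assumption.
  - apply comp_id_r.
  - rewrite comp_id_l. apply comp_id_r.
  - apply comp_id_r.
  - rewrite comp_id_r. exact Q4. }
unfold square in H. rewrite !on_id, comp_id_l, comp_id_r in H. exact H.
Qed.

Lemma Pi_square_refl F : Pi_square (F := F) (G := F) (id_sub _) (id_sub _) (id_sub _) (id_sub _).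
Proof.
split; [apply square_refl|]. exists (id_sub _).
split; [apply square_refl|]. split; apply square_refl.
Qed.

Lemma Pi_square_paste F G H (φ : sub (F Γ) (G Γ)) (α : sub (F (Γ ▷ A)) (G (Γ ▷ A)))
    (β : sub (F (Γ ▷ A ▷ B)) (G (Γ ▷ A ▷ B))) (π : sub (F (Γ ▷ Pi R B)) (G (Γ ▷ Pi R B)))
    (φ' : sub (G Γ) (H Γ)) (α' : sub (G (Γ ▷ A)) (H (Γ ▷ A)))
    (β' : sub (G (Γ ▷ A ▷ B)) (H (Γ ▷ A ▷ B))) (π' : sub (G (Γ ▷ Pi R B)) (H (Γ ▷ Pi R B))) :
  Pi_square φ α β π -> Pi_square φ' α' β' π' ->
  Pi_square (φ' ∘ φ) (α' ∘ α) (β' ∘ β) (π' ∘ π).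
Proof.
intros [P1 [ρ [P2 [P3 P4]]]] [Q1 [ρ' [Q2 [Q3 Q4]]]].
split; [exact (square_paste P1 Q1)|]. exists (ρ' ∘ ρ).
split; [exact (square_paste P2 Q2)|].
split; [exact (square_paste P3 Q3)|exact (square_paste P4 Q4)].
Qed.

Lemma Pi_square_iso F G (φ : sub (F Γ) (G Γ)) (α : sub (F (Γ ▷ A)) (G (Γ ▷ A)))
    (β : sub (F (Γ ▷ A ▷ B)) (G (Γ ▷ A ▷ B))) :
  is_iso φ -> is_iso α -> is_iso β -> square (wk A) α φ -> square (wk B) β α ->
  exists π, is_iso π /\ Pi_square φ α β π.
Proof.
intros Iφ Iα [β' [Hβ Hβ']] HA HB.
destruct (Iφ) as [φ' [Hφ Hφ']]. destruct (Iα) as [α' [Hα Hα']].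
destruct (Pi_square_ex Iφ Iα HA HB) as [π HP].
destruct (@Pi_square_ex G F φ' α' β') as [π' HP'].
- exists φ. split; assumption.
- exists α. split; assumption.
- exact (square_inv Hφ Hα' HA).
- exact (square_inv Hα Hβ' HB).
- exists π. split; [|exact HP]. exists π'. split.
  + apply (@Pi_square_unique F F (id_sub _) (id_sub _) (id_sub _));
      try apply is_iso_id; [apply square_refl| |apply Pi_square_refl].
    rewrite <- Hφ, <- Hα, <- Hβ. exact (Pi_square_paste HP HP').
  + apply (@Pi_square_unique G G (id_sub _) (id_sub _) (id_sub _));
      try apply is_iso_id; [apply square_refl| |apply Pi_square_refl].
    rewrite <- Hφ', <- Hα', <- Hβ'. exact (Pi_square_paste HP' HP).
Qed.

(* [unpair B] is invertible already in the source, so every functor preserves Σ-types. *)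
Lemma Sigma_square_iso F G (β : sub (F (Γ ▷ A ▷ B)) (G (Γ ▷ A ▷ B))) :
  is_iso β -> exists s, is_iso s /\ square (unpair B) s β.
Proof.
intros Hβ. destruct (unpair_is_iso B) as [p [P1 P2]].
exists (on_sub G p ∘ β ∘ on_sub F (unpair B)). split.
- apply is_iso_comp; [apply is_iso_comp; [|exact Hβ]|].
  + exists (on_sub G (unpair B)). rewrite <- !on_comp, P1, P2, !on_id. split; reflexivity.
  + exists (on_sub F p). rewrite <- !on_comp, P1, P2, !on_id. split; reflexivity.
- unfold square. rewrite !comp_assoc, <- on_comp, P2, on_id, comp_id_l. reflexivity.
Qed.

Lemma square_into_Sigma F G (β : sub (F (Γ ▷ A ▷ B)) (G (Γ ▷ A ▷ B)))
    (s : sub (F (Γ ▷ Sigma R B)) (G (Γ ▷ Sigma R B))) Θ (θ : sub (F Θ) (G Θ))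
    (k : sub Θ (Γ ▷ Sigma R B)) :
  square (unpair B) s β -> square (unpair B ∘ k) θ β -> square k θ s.
Proof.
unfold square. intros Hs Hk.
assert (I : is_iso (on_sub G (unpair B))).
{ destruct (unpair_is_iso B) as [p [P1 P2]]. exists (on_sub G p).
  rewrite <- !on_comp, P1, P2, !on_id. split; reflexivity. }
apply (iso_mono I). rewrite !comp_assoc, <- Hs, <- comp_assoc, <- !on_comp. exact Hk.
Qed.

End Pi.

Lemma square_into_Eq F G Γ (A : ty Γ) (a b : tm A) (φ : sub (F Γ) (G Γ))
    (q : sub (F (Γ ▷ Eq R a b)) (G (Γ ▷ Eq R a b))) Θ (θ : sub (F Θ) (G Θ))
    (k : sub Θ (Γ ▷ Eq R a b)) :
  square (wk (Eq R a b)) q φ -> square (wk (Eq R a b) ∘ k) θ φ -> square k θ q.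
Proof.
unfold square. intros Hq Hk. apply on_wk_Eq_mono.
rewrite !comp_assoc, <- Hq, <- comp_assoc, <- !on_comp. exact Hk.
Qed.

Lemma Eq_square_ex F G Γ (A : ty Γ) (a b : tm A) (φ : sub (F Γ) (G Γ))
    (α : sub (F (Γ ▷ A)) (G (Γ ▷ A))) :
  square (sing a) φ α -> square (sing b) φ α -> exists q, square (wk (Eq R a b)) q φ.
Proof.
intros Ha Hb.
destruct (@on_Eq_ex R S G _ _ a b _ (φ ∘ on_sub F (wk (Eq R a b)))) as [q Hq].
- rewrite !comp_assoc, <- Ha, <- Hb, <- !comp_assoc, <- !on_comp, wk_Eq_equalizes.
  reflexivity.
- exists q. symmetry. exact Hq.
Qed.

Lemma Eq_square_iso F G Γ (A : ty Γ) (a b : tm A) (φ : sub (F Γ) (G Γ))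
    (α : sub (F (Γ ▷ A)) (G (Γ ▷ A))) :
  is_iso φ -> is_iso α -> square (sing a) φ α -> square (sing b) φ α ->
  exists q, is_iso q /\ square (wk (Eq R a b)) q φ.
Proof.
intros [φ' [Hφ Hφ']] [α' [Hα Hα']] Ha Hb.
destruct (Eq_square_ex Ha Hb) as [q Hq].
destruct (Eq_square_ex (square_inv Hα Hφ' Ha) (square_inv Hα Hφ' Hb)) as [q' Hq'].
exists q. split; [|exact Hq]. exists q'. split; apply on_wk_Eq_mono.
- rewrite <- (square_paste Hq Hq'), Hφ, comp_id_l, comp_id_r. reflexivity.
- rewrite <- (square_paste Hq' Hq), Hφ', comp_id_l, comp_id_r. reflexivity.
Qed.

Lemma on_wk_Unit_iso F Γ : is_iso (on_sub F (wk (Unit R Γ))).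
Proof.
destruct (wk_Unit_iso Γ) as [p [P1 P2]]. exists (on_sub F p).
rewrite <- !on_comp, P1, P2, !on_id. split; reflexivity.
Qed.

Lemma Unit_square_iso F G Γ (φ : sub (F Γ) (G Γ)) :
  is_iso φ -> exists u, is_iso u /\ square (wk (Unit R Γ)) u φ.
Proof.
intros Hφ. destruct (on_wk_Unit_iso G Γ) as [p [P1 P2]].
exists (p ∘ φ ∘ on_sub F (wk (Unit R Γ))). split.
- apply is_iso_comp; [apply is_iso_comp; [|exact Hφ]|apply on_wk_Unit_iso].
  exists (on_sub G (wk (Unit R Γ))). split; assumption.
- unfold square. rewrite !comp_assoc, P2, comp_id_l. reflexivity.
Qed.

Lemma square_into_Unit F G Γ (φ : sub (F Γ) (G Γ))
    (u : sub (F (Γ ▷ Unit R Γ)) (G (Γ ▷ Unit R Γ))) Θ (θ : sub (F Θ) (G Θ))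
    (k : sub Θ (Γ ▷ Unit R Γ)) :
  square (wk (Unit R Γ)) u φ -> square (wk (Unit R Γ) ∘ k) θ φ -> square k θ u.
Proof.
unfold square. intros Hu Hk. apply (iso_mono (on_wk_Unit_iso G Γ)).
rewrite !comp_assoc, <- Hu, <- comp_assoc, <- !on_comp. exact Hk.
Qed.

(** The last equation forces [u], because [weak_U G] and the comparison are invertible. The square
    over [φ] holds because [G empty] is terminal. *)
Lemma U_square_iso F G (φ : sub (F empty) (G empty)) :
  exists u, is_iso u /\ square (wk (U R)) u φ /\
    weak_U G ∘ ext_cmp G (U R) ∘ u = weak_U F ∘ ext_cmp F (U R).
Proof.
destruct (weak_U_iso G) as [_ [wG [W1 W2]]], (weak_U_iso F) as [_ HF].
assert (I : is_iso (weak_U G ∘ ext_cmp G (U R))).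
{ apply is_iso_comp; [exists wG; split; assumption|apply ext_cmp_iso]. }
destruct I as [j [J1 J2]].
exists (j ∘ (weak_U F ∘ ext_cmp F (U R))). split; [|split].
- apply is_iso_comp; [exists (weak_U G ∘ ext_cmp G (U R)); split; assumption|].
  apply is_iso_comp; [exact HF|apply ext_cmp_iso].
- destruct (on_empty G (F (empty ▷ U R))) as [t Ht]. unfold square.
  rewrite (Ht (φ ∘ _)), (Ht (on_sub G _ ∘ _)). reflexivity.
- rewrite comp_assoc, J2. apply comp_id_l.
Qed.

(** [v] is forced in the same way. It lies over [u] because [weak_El] lies over [weak_U] for both
    morphisms; this is checked after composing with an isomorphism out of [G (empty ▷ U R)]. *)
Lemma El_square_iso F G (u : sub (F (empty ▷ U R)) (G (empty ▷ U R))) :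
  weak_U G ∘ ext_cmp G (U R) ∘ u = weak_U F ∘ ext_cmp F (U R) ->
  exists v, is_iso v /\ square (wk (El R)) v u /\
    weak_El G ∘ ext_cmp G (El R) ∘ v = weak_El F ∘ ext_cmp F (El R).
Proof.
intros Hu.
destruct (weak_U_iso G) as [_ HG].
destruct (weak_El_iso G) as [EG HEG], (weak_El_iso F) as [EF HEF].
assert (I : is_iso (weak_El G ∘ ext_cmp G (El R))).
{ apply is_iso_comp; [exact HEG|apply ext_cmp_iso]. }
assert (J : is_iso (weak_U G ∘ ext_cmp G (U R))).
{ apply is_iso_comp; [exact HG|apply ext_cmp_iso]. }
destruct (I) as [j [J1 J2]].
exists (j ∘ (weak_El F ∘ ext_cmp F (El R))).
assert (K : weak_El G ∘ ext_cmp G (El R) ∘ (j ∘ (weak_El F ∘ ext_cmp F (El R)))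
  = weak_El F ∘ ext_cmp F (El R)) by (rewrite comp_assoc, J2; apply comp_id_l).
split; [|split; [|exact K]].
- apply is_iso_comp; [exists (weak_El G ∘ ext_cmp G (El R)); split; assumption|].
  apply is_iso_comp; [exact HEF|apply ext_cmp_iso].
- revert K. generalize (j ∘ (weak_El F ∘ ext_cmp F (El R))). intros v K.
  unfold square. apply (iso_mono J).
  rewrite (comp_assoc _ u), Hu, <- (wk_ext_cmp F), (comp_assoc _ (wk _)), <- EF.
  rewrite <- comp_assoc, <- K, !comp_assoc, EG.
  rewrite <- (wk_ext_cmp G), !comp_assoc. reflexivity.
Qed.

End TypeFormerSquares.

(** * The iso-inserter *)

Section IsoInserter.
Variables (R S : RFCat) (F G : WeakRFMor R S).

Record iso_ctx : Type := {
  ictx : R;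
  ictx_map : sub (F ictx) (G ictx);
  ictx_iso : is_iso ictx_map
}.

Record iso_sub (Δ Γ : iso_ctx) : Type := {
  isub :> sub (ictx Δ) (ictx Γ);
  isub_square : square isub (ictx_map Δ) (ictx_map Γ)
}.

Record iso_ty (Γ : iso_ctx) : Type := {
  ity : ty (ictx Γ);
  ity_map : sub (F (ictx Γ ▷ ity)) (G (ictx Γ ▷ ity));
  ity_iso : is_iso ity_map;
  ity_square : square (wk ity) ity_map (ictx_map Γ)
}.

Record iso_tm (Γ : iso_ctx) (A : iso_ty Γ) : Type := {
  itm : tm (ity A);
  itm_square : square (sing itm) (ictx_map Γ) (ity_map A)
}.

Lemma iso_sub_eq Γ Δ (σ τ : iso_sub Δ Γ) : isub σ = isub τ -> σ = τ.
Proof.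
destruct σ as [s h], τ as [t k]. simpl. intros <-. f_equal. apply proof_irrelevance.
Qed.

Lemma iso_tm_eq Γ (A : iso_ty Γ) (a b : iso_tm A) : itm a = itm b -> a = b.
Proof.
destruct a as [s h], b as [t k]. simpl. intros <-. f_equal. apply proof_irrelevance.
Qed.

Definition iso_id Γ : iso_sub Γ Γ :=
  {| isub := id_sub _; isub_square := square_id (ictx_map Γ) |}.

Definition iso_comp Γ Δ Θ (σ : iso_sub Δ Γ) (τ : iso_sub Θ Δ) : iso_sub Θ Γ :=
  {| isub := isub σ ∘ isub τ; isub_square := square_comp (isub_square σ) (isub_square τ) |}.

Lemma terminal_map_ex : exists φ : sub (F empty) (G empty), is_iso φ.
Proof.
destruct (on_empty G (F empty)) as [f _], (on_empty F (G empty)) as [g _].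
exists f, g. split.
- destruct (on_empty F (F empty)) as [t Ht]. rewrite (Ht (g ∘ f)). symmetry. apply Ht.
- destruct (on_empty G (G empty)) as [t Ht]. rewrite (Ht (f ∘ g)). symmetry. apply Ht.
Qed.

Definition iso_empty : iso_ctx :=
  let c := constructive_indefinite_description _ terminal_map_ex in
  {| ictx := empty; ictx_map := proj1_sig c; ictx_iso := proj2_sig c |}.

Lemma bang_square Γ : square (Γ := empty) (bang (ictx Γ)) (ictx_map Γ) (ictx_map iso_empty).
Proof.
unfold square. destruct (on_empty G (F (ictx Γ))) as [t Ht].
rewrite (Ht (_ ∘ on_sub F _)). symmetry. apply Ht.
Qed.

Definition iso_bang Γ : iso_sub Γ iso_empty := 
  Build_iso_sub (Γ := iso_empty) (bang_square Γ).

Lemma iso_ty_sub_ex Γ Δ (A : iso_ty Γ) (σ : iso_sub Δ Γ) :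
  exists β : sub (F (ictx Δ ▷ (ity A)⟦isub σ⟧)) (G (ictx Δ ▷ (ity A)⟦isub σ⟧)),
    is_iso β /\ square (wk _) β (ictx_map Δ) /\ square (lift _ σ) β (ity_map A).
Proof.
apply cartesian_square_iso with (φ := ictx_map Γ);
  first [apply ictx_iso|apply ity_iso|apply isub_square|apply ity_square].
Qed.

(** The choice is harmless: [cartesian_square_unique] leaves a single candidate. *)
Definition iso_ty_sub Γ Δ (A : iso_ty Γ) (σ : iso_sub Δ Γ) : iso_ty Δ :=
  let c := constructive_indefinite_description _ (iso_ty_sub_ex A σ) in
  {| ity := (ity A)⟦isub σ⟧;
     ity_map := proj1_sig c;
     ity_iso := proj1 (proj2_sig c);
     ity_square := proj1 (proj2 (proj2_sig c)) |}.

Lemma iso_lift_square Γ Δ (A : iso_ty Γ) (σ : iso_sub Δ Γ) :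
  square (lift (ity A) σ) (ity_map (iso_ty_sub A σ)) (ity_map A).
Proof. apply (proj2_sig (constructive_indefinite_description _ (iso_ty_sub_ex A σ))). Qed.

(** The square over [ext_map e], which becomes an identity once the underlying types are identified,
    expresses equality of the components without transport. *)
Lemma iso_ty_eq Γ (A B : iso_ty Γ) (e : ity A = (ity B)⟦id_sub _⟧) :
  square (ext_map e) (ity_map A) (ity_map B) -> A = B.
Proof.
destruct A as [A α Iα Wα], B as [B β Iβ Wβ]. simpl in *. intros H.
assert (E : A = B) by (rewrite e; apply ty_sub_id). subst B.
rewrite ext_map_eq_id in H by reflexivity. unfold square in H.
rewrite !on_id, comp_id_l, comp_id_r in H. subst β.
f_equal; apply proof_irrelevance.
Qed.

(** Every stability law below is reduced by this lemma to one square, by uniqueness of cartesian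
    components. *)
Lemma iso_ty_sub_eq Γ Δ (A : iso_ty Γ) (B : iso_ty Δ) (σ : iso_sub Δ Γ)
    (e : ity B = (ity A)⟦isub σ⟧) :
  square (ext_map e) (ity_map B) (ity_map A) -> B = iso_ty_sub A σ.
Proof.
intros H.
assert (e' : ity B = (ity (iso_ty_sub A σ))⟦id_sub _⟧) by (rewrite ty_sub_id; exact e).
apply (@iso_ty_eq _ _ _ e').
apply (square_cartesian (ity_square (iso_ty_sub A σ)) (iso_lift_square A σ)).
- rewrite wk_ext_map, comp_id_l. apply ity_square.
- assert (K : ext_map (eq_refl (ity A)⟦σ⟧) ∘ ext_map e' = ext_map e)
    by (apply ext_map_comp, comp_id_r).
  rewrite <- K in H. exact H.
Qed.

(** Converse to [iso_ty_sub_eq]. The separate [s] is for substitutions such as [lift A σ], whose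
    underlying map has the expected form only by a proved equation. *)
Lemma iso_ext_map_square Γ Δ (A : iso_ty Γ) (B : iso_ty Δ) (σ : iso_sub Δ Γ)
    (E : B = iso_ty_sub A σ) (s : sub (ictx Δ) (ictx Γ)) (e : ity B = (ity A)⟦s⟧) :
  isub σ = s -> square (ext_map e) (ity_map B) (ity_map A).
Proof.
intros H. subst s B. rewrite (proof_irrelevance _ e eq_refl). apply iso_lift_square.
Qed.

Lemma iso_ty_sub_id Γ (A : iso_ty Γ) : iso_ty_sub A (iso_id Γ) = A.
Proof.
symmetry. apply iso_ty_sub_eq with (e := ty_sub_eq_id (ity A) eq_refl).
rewrite ext_map_eq_id by reflexivity. apply square_id.
Qed.

Lemma iso_ty_sub_comp Γ Δ Θ (A : iso_ty Γ) (σ : iso_sub Δ Γ) (τ : iso_sub Θ Δ) :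
  iso_ty_sub A (iso_comp σ τ) = iso_ty_sub (iso_ty_sub A σ) τ.
Proof.
symmetry.
apply iso_ty_sub_eq with (e := eq_sym (ty_sub_comp (ity A) (isub σ) (isub τ))).
rewrite <- (ext_map_comp (eq_refl (ity A)⟦σ⟧) (eq_refl (ity A)⟦σ⟧⟦τ⟧) _ eq_refl).
apply (square_comp (iso_lift_square A σ) (iso_lift_square (iso_ty_sub A σ) τ)).
Qed.

Lemma iso_tm_sub_square Γ Δ (A : iso_ty Γ) (B : iso_ty Δ) (σ : iso_sub Δ Γ)
    (E : B = iso_ty_sub A σ) (a : iso_tm A) :
  square (sing (tm_sub (isub σ) (f_equal (@ity Δ) E) (itm a))) (ictx_map Δ) (ity_map B).
Proof.
apply (square_cartesian (ity_square B) (iso_ext_map_square E (f_equal (@ity Δ) E) eq_refl)).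
- rewrite wk_sing. apply square_id.
- rewrite ext_map_sing. apply (square_comp (itm_square a) (isub_square σ)).
Qed.

Definition iso_tm_sub Γ Δ (A : iso_ty Γ) (B : iso_ty Δ) (σ : iso_sub Δ Γ)
    (E : B = iso_ty_sub A σ) (a : iso_tm A) : iso_tm B :=
  {| itm := tm_sub (isub σ) (f_equal (@ity Δ) E) (itm a);
     itm_square := iso_tm_sub_square E a |}.

Definition iso_ext (Γ : iso_ctx) (A : iso_ty Γ) : iso_ctx :=
  {| ictx := ictx Γ ▷ ity A; ictx_map := ity_map A; ictx_iso := ity_iso A |}.

Definition iso_wk (Γ : iso_ctx) (A : iso_ty Γ) : iso_sub (iso_ext A) Γ :=
  Build_iso_sub (Δ := iso_ext A) (ity_square A).

Lemma iso_var_square (Γ : iso_ctx) (A : iso_ty Γ) :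
  square (sing (var (ity A))) (ity_map A) (ity_map (iso_ty_sub A (iso_wk A))).
Proof.
apply (square_cartesian (ity_square (iso_ty_sub A (iso_wk A))) (iso_lift_square A (iso_wk A))).
- rewrite wk_sing. apply square_id.
- assert (H := ext_map_cast_var (eq_refl (ity A)⟦wk (ity A)⟧) eq_refl).
  simpl in *. rewrite H. apply square_id.
Qed.

Definition iso_var (Γ : iso_ctx) (A : iso_ty Γ) : iso_tm (iso_ty_sub A (iso_wk A)) :=
  Build_iso_tm (A := iso_ty_sub A (iso_wk A)) (iso_var_square A).

Lemma iso_pair_square Γ Δ (A : iso_ty Γ) (σ : iso_sub Δ Γ) (a : iso_tm (iso_ty_sub A σ)) :
  square (pair (ity A) σ (itm a)) (ictx_map Δ) (ity_map A).
Proof.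
rewrite <- lift_sing. apply (square_comp (iso_lift_square A σ) (itm_square a)).
Qed.

Definition iso_pair Γ Δ (A : iso_ty Γ) (σ : iso_sub Δ Γ) (a : iso_tm (iso_ty_sub A σ)) :
    iso_sub Δ (iso_ext A) :=
  Build_iso_sub (Γ := iso_ext A) (iso_pair_square a).

Definition iso_cwf : CwF.
Proof.
refine {|
  ctx := iso_ctx;
  sub := iso_sub;
  id_sub := iso_id;
  comp := iso_comp;
  empty := iso_empty;
  bang := iso_bang;
  ty := iso_ty;
  ty_sub := iso_ty_sub;
  ty_sub_id := iso_ty_sub_id;
  ty_sub_comp := iso_ty_sub_comp;
  tm := iso_tm;
  tm_sub := iso_tm_sub;
  ext := iso_ext;
  wk := iso_wk;
  var := iso_var;
  pair := iso_pair |}.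
- intros. apply iso_sub_eq, comp_id_l.
- intros. apply iso_sub_eq, comp_id_r.
- intros. apply iso_sub_eq, comp_assoc.
- intros. apply iso_sub_eq, bang_unique.
- intros. apply iso_tm_eq, tm_sub_id.
- intros. apply iso_tm_eq, tm_sub_comp.
- intros. apply iso_sub_eq, wk_pair.
- intros. apply iso_tm_eq, var_pair.
- intros. apply iso_sub_eq, pair_eta.
Defined.

Lemma itm_cast (Γ : iso_cwf) (A B : ty Γ) (e : A = B) (e' : ity A = ity B) (a : tm A) :
  itm (tm_cast e a) = tm_cast e' (itm a).
Proof. subst B. rewrite (tm_cast_irr e' eq_refl). reflexivity. Qed.

Lemma isub_ext_map (Γ Δ : iso_cwf) (A : ty Γ) (B : ty Δ) (σ : sub Δ Γ) (e : B = A⟦σ⟧)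
    (e' : ity B = (ity A)⟦isub σ⟧) :
  isub (ext_map e) = ext_map e'.
Proof.
assert (e2 : ity B⟦wk B⟧ = ity A⟦σ ∘ wk B⟧) by exact (ext_map_ty e').
unfold ext_map. simpl. rewrite (itm_cast _ e2).
f_equal. apply tm_cast_irr.
Qed.

Lemma isub_lift (Γ Δ : iso_cwf) (A : ty Γ) (σ : sub Δ Γ) :
  isub (lift A σ) = lift (ity A) (isub σ).
Proof. apply (isub_ext_map eq_refl eq_refl). Qed.

Lemma lift_ty_eq (Γ Δ : iso_cwf) (A : ty Γ) (B : ty (Γ ▷ A)) (σ : sub Δ Γ) :
  ity B⟦lift A σ⟧ = (ity B)⟦lift (ity A) (isub σ)⟧.
Proof. rewrite <- isub_lift. reflexivity. Qed.

(** * Π-types of the iso-inserter *)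

Section IsoPi.
Variables (Γ : iso_cwf) (A : ty Γ) (B : ty (Γ ▷ A)).

Lemma iso_Pi_ex :
  exists π, is_iso π /\ Pi_square (ictx_map Γ) (ity_map A) (ity_map B) π.
Proof.
apply Pi_square_iso;
  [apply (ictx_iso Γ)|apply (ity_iso A)|apply (ity_iso B)|apply (ity_square A)|
   apply (ity_square B)].
Qed.

Definition iso_Pi : ty Γ :=
  let c := constructive_indefinite_description _ iso_Pi_ex in
  {| ity := Pi R (ity B);
     ity_map := proj1_sig c;
     ity_iso := proj1 (proj2_sig c);
     ity_square := proj1 (proj2 (proj2_sig c)) |}.

Lemma iso_Pi_square : Pi_square (ictx_map Γ) (ity_map A) (ity_map B) (ity_map iso_Pi).
Proof. apply (proj2_sig (constructive_indefinite_description _ iso_Pi_ex)). Qed.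

(** The auxiliary map in [Pi_square] satisfies the squares that characterize the component of the
    substituted type, so the two agree. *)
Lemma iso_ev_square :
  square (ev (ity B)) (ity_map A⟦wk iso_Pi⟧) (ity_map B).
Proof.
destruct iso_Pi_square as [P1 [π' [P2 [P3 P4]]]].
replace (ity_map A⟦wk iso_Pi⟧) with π'; [exact P4|].
apply (@cartesian_square_unique _ _ F G _ _ _ _ _ (eq_refl (ity A)⟦wk (Pi R (ity B))⟧)
  (ity_map iso_Pi) (ity_map A)); try assumption.
- apply (ity_square A⟦wk iso_Pi⟧).
- apply (iso_lift_square A (wk iso_Pi)).
Qed.

Lemma iso_square_into_Pi (Θ : iso_cwf) (σ : sub Θ Γ) (k : sub (ictx Θ) (ictx Γ ▷ Pi R (ity B)))
    (A' : ty Θ) (e : ity A' = (ity A)⟦isub σ⟧)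
    (k' : sub (ictx Θ ▷ ity A') (ictx Γ ▷ Pi R (ity B) ▷ (ity A)⟦wk (Pi R (ity B))⟧)) :
  wk _ ∘ k = isub σ -> square (ext_map e) (ity_map A') (ity_map A) ->
  wk _ ∘ k' = k ∘ wk (ity A') -> lift (ity A) _ ∘ k' = ext_map e ->
  square (ev (ity B) ∘ k') (ity_map A') (ity_map B) ->
  square k (ictx_map Θ) (ity_map iso_Pi).
Proof.
intros Hk He K1 K2 H.
apply (@square_into_Pi R S _ _ _ F G (ictx_map Γ) (ity_map A) (ity_map B) _ _ _ k (isub σ)
  (ity A') e (ity_map A') k'); try assumption.
- apply (ictx_iso Γ).
- apply (ity_iso A).
- apply (ity_square A).
- apply iso_Pi_square.
- apply (isub_square σ).
- apply (ity_square A').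
Qed.

(** Naturality of a section of the Π-type is tested after evaluation, where [Pi_beta] leaves
    naturality of [b]. *)
Lemma iso_lam_square (b : tm B) :
  square (sing (lam R (itm b))) (ictx_map Γ) (ity_map iso_Pi).
Proof.
destruct (sing_lift_ex (lam R (itm b))) as [k' [K1 [K2 K3]]].
assert (e : ity A = (ity A)⟦id_sub _⟧) by (symmetry; apply ty_sub_id).
apply (@iso_square_into_Pi Γ (id_sub Γ) _ A e k').
- apply wk_sing.
- apply square_eq_id, ext_map_eq_id. reflexivity.
- exact K1.
- rewrite K2. symmetry. apply ext_map_eq_id. reflexivity.
- rewrite K3, Pi_beta. apply (itm_square b).
Qed.

Definition iso_lam (b : tm B) : tm iso_Pi := Build_iso_tm (A := iso_Pi) (iso_lam_square b).

Lemma iso_app_square (f : tm iso_Pi) :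
  square (sing (app R (itm f))) (ity_map A) (ity_map B).
Proof.
destruct (sing_lift_ex (itm f)) as [k' [K1 [K2 K3]]]. rewrite <- K3.
apply (square_comp iso_ev_square).
apply (square_cartesian (ity_square A⟦wk iso_Pi⟧) (iso_lift_square A (wk iso_Pi))).
- refine (eq_ind_r (fun s => square s _ _) _ K1). apply (square_comp (itm_square f) (ity_square A)).
- refine (eq_ind_r (fun s => square s _ _) _ K2). apply square_id.
Qed.

Definition iso_app (f : tm iso_Pi) : tm B := Build_iso_tm (A := B) (iso_app_square f).

End IsoPi.

Lemma iso_Pi_sub (Γ Δ : iso_cwf) (A : ty Γ) (B : ty (Γ ▷ A)) (σ : sub Δ Γ) :
  (iso_Pi B)⟦σ⟧ = iso_Pi B⟦lift A σ⟧.
Proof.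
symmetry. set (B' := B⟦lift A σ⟧). set (P' := iso_Pi B').
assert (eB : ity B' = (ity B)⟦ext_map (eq_refl (ity A)⟦isub σ⟧)⟧) by apply lift_ty_eq.
assert (e : Pi R (ity B') = (Pi R (ity B))⟦isub σ⟧) by exact (Pi_sub_gen eB).
apply (@iso_ty_sub_eq _ _ (iso_Pi B) P' σ e).
set (p := wk P').
assert (e' : ity A⟦σ⟧⟦p⟧ = (ity A)⟦isub (σ ∘ p)⟧).
{ simpl. symmetry. apply ty_sub_comp. }
(* [k'] is the pullback of [ext_map e] to the domains of evaluation. With it, the required square is
   tested after [ev], and [ev_natural] splits the result into two known squares. *)
destruct (ext_map_ex (eq_refl (ity A)⟦wk (Pi R (ity B))⟧)
  (u := ext_map e ∘ wk (ity A⟦σ⟧⟦p⟧)) (v := ext_map e')) as [k' [K1 K2]].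
{ rewrite comp_assoc, !wk_ext_map. reflexivity. }
assert (K2' : ext_map e' = lift (ity A) (isub σ) ∘ lift ((ity A)⟦isub σ⟧) (isub p)).
{ symmetry. apply ext_map_comp. reflexivity. }
apply (@iso_square_into_Pi _ _ B (Δ ▷ P') (σ ∘ p) (ext_map e) A⟦σ⟧⟦p⟧ e' k').
- apply wk_ext_map.
- rewrite K2'.
  apply (square_comp (iso_lift_square A σ) (iso_lift_square A⟦σ⟧ p)).
- exact K1.
- exact K2.
- rewrite (@ev_natural R _ _ _ _ _ _ _ _ eB e).
  + apply (square_comp (δ := ity_map B')); [|apply (@iso_ev_square Δ A⟦σ⟧ B')].
    apply (iso_ext_map_square (A := B) (σ := lift A σ) eq_refl eB (isub_lift A σ)).
  + exact K1.
  + exact (eq_trans K2 K2').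
Qed.

Definition iso_pi_structure : PiStructure iso_cwf.
Proof.
refine {| Pi := iso_Pi; lam := iso_lam; app := iso_app; Pi_sub := iso_Pi_sub |}.
- intros. apply iso_tm_eq, Pi_beta.
- intros. apply iso_tm_eq, Pi_eta.
- intros Γ Δ A B σ b e. apply iso_tm_eq.
  assert (eB := lift_ty_eq B σ).
  refine (eq_trans (lam_sub_gen (eA := eq_refl (ity A)⟦isub σ⟧) eB
    (f_equal (@ity Δ) e) (itm b)) _).
  apply (f_equal (fun x => lam R x)). apply tm_sub_eq. symmetry. apply isub_lift.
Defined.

(** * Σ-types of the iso-inserter *)

Section IsoSigma.
Variables (Γ : iso_cwf) (A : ty Γ) (B : ty (Γ ▷ A)).

Lemma iso_Sigma_ex : exists s, is_iso s /\ square (unpair (ity B)) s (ity_map B).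
Proof. apply Sigma_square_iso. apply (ity_iso B). Qed.

Lemma iso_Sigma_wk_square (s : sub _ _) : square (unpair (ity B)) s (ity_map B) ->
  square (wk (Sigma R (ity B))) s (ictx_map Γ).
Proof.
intros H. rewrite <- wk_unpair.
apply (square_comp (ity_square A)). apply (square_comp (ity_square B)). exact H.
Qed.

Definition iso_Sigma : ty Γ :=
  let c := constructive_indefinite_description _ iso_Sigma_ex in
  {| ity := Sigma R (ity B);
     ity_map := proj1_sig c;
     ity_iso := proj1 (proj2_sig c);
     ity_square := iso_Sigma_wk_square (proj2 (proj2_sig c)) |}.

Lemma iso_unpair_square : square (unpair (ity B)) (ity_map iso_Sigma) (ity_map B).
Proof. apply (proj2_sig (constructive_indefinite_description _ iso_Sigma_ex)). Qed.

Lemma iso_lift_sing_square (a : tm A) :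
  square (lift (ity B) (sing (itm a))) (ity_map B⟦sing a⟧) (ity_map B).
Proof. apply (iso_lift_square B (sing a)). Qed.

Lemma iso_spair_square (a : tm A) (b : tm B⟦sing a⟧) :
  square (sing (spair R (itm b : tm (ity B)⟦sing (itm a)⟧)))
    (ictx_map Γ) (ity_map iso_Sigma).
Proof.
apply (square_into_Sigma iso_unpair_square).
rewrite unpair_sing, split_pair_spair.
apply (square_comp (iso_lift_sing_square a) (itm_square b)).
Qed.

Definition iso_spair (a : tm A) (b : tm B⟦sing a⟧) : tm iso_Sigma :=
  Build_iso_tm (A := iso_Sigma) (iso_spair_square b).

Lemma iso_split_square (t : tm iso_Sigma) :
  square (split_pair (itm t)) (ictx_map Γ) (ity_map B).
Proof.
rewrite <- unpair_sing. apply (square_comp iso_unpair_square (itm_square t)).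
Qed.

Lemma iso_fst_square (t : tm iso_Sigma) :
  square (sing (fst R (itm t))) (ictx_map Γ) (ity_map A).
Proof.
rewrite <- wk_split_pair. apply (square_comp (ity_square B) (iso_split_square t)).
Qed.

Definition iso_fst (t : tm iso_Sigma) : tm A := Build_iso_tm (A := A) (iso_fst_square t).

Lemma iso_snd_square (t : tm iso_Sigma) :
  square (sing (snd R (itm t))) (ictx_map Γ) (ity_map B⟦sing (iso_fst t)⟧).
Proof.
apply (square_cartesian (ity_square B⟦sing (iso_fst t)⟧) (iso_lift_sing_square (iso_fst t))).
- rewrite wk_sing. apply square_id.
- apply iso_split_square.
Qed.

Definition iso_snd (t : tm iso_Sigma) : tm B⟦sing (iso_fst t)⟧ :=
  Build_iso_tm (A := B⟦sing (iso_fst t)⟧) (iso_snd_square t).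

End IsoSigma.

Lemma iso_Sigma_sub (Γ Δ : iso_cwf) (A : ty Γ) (B : ty (Γ ▷ A)) (σ : sub Δ Γ) :
  (iso_Sigma B)⟦σ⟧ = iso_Sigma B⟦lift A σ⟧.
Proof.
symmetry.
assert (eB := lift_ty_eq B σ).
assert (e : Sigma R (ity B⟦lift A σ⟧) = (Sigma R (ity B))⟦isub σ⟧)
  by exact (Sigma_sub_gen (eA := eq_refl (ity A)⟦isub σ⟧) eB).
apply (@iso_ty_sub_eq _ _ (iso_Sigma B) (iso_Sigma B⟦lift A σ⟧) σ e).
apply (square_into_Sigma (iso_unpair_square B)).
refine (eq_ind_r (fun s => square s _ _) _
  (unpair_natural (eA := eq_refl (ity A)⟦isub σ⟧) eB e)).
apply (square_comp (δ := ity_map B⟦lift A σ⟧)).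
- apply (iso_ext_map_square (A := B) (σ := lift A σ) eq_refl eB (isub_lift A σ)).
- apply iso_unpair_square.
Qed.

Definition iso_sigma_structure : SigmaStructure iso_cwf.
Proof.
refine {| Sigma := iso_Sigma; spair := iso_spair; fst := iso_fst; snd := iso_snd;
  Sigma_sub := iso_Sigma_sub |}.
- intros. apply iso_tm_eq, fst_spair.
- intros. apply iso_tm_eq. rewrite (itm_cast _ (f_equal (@ity _) e)). apply snd_spair.
- intros. apply iso_tm_eq, spair_eta.
- intros Γ Δ A B σ a b e e'. apply iso_tm_eq.
  assert (eB := lift_ty_eq B σ).
  apply (spair_sub_gen (eA := eq_refl (ity A)⟦isub σ⟧) eB
    (f_equal (@ity Δ) e) (itm b) (f_equal (@ity Δ) e')).
Defined.

(** * Equality and unit types of the iso-inserter *)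

Section IsoEq.
Variables (Γ : iso_cwf) (A : ty Γ) (a b : tm A).

Lemma iso_Eq_ex : exists q, is_iso q /\ square (wk (Eq R (itm a) (itm b))) q (ictx_map Γ).
Proof.
apply (Eq_square_iso (ictx_iso Γ) (ity_iso A) (itm_square a) (itm_square b)).
Qed.

Definition iso_Eq : ty Γ :=
  let c := constructive_indefinite_description _ iso_Eq_ex in
  {| ity := Eq R (itm a) (itm b);
     ity_map := proj1_sig c;
     ity_iso := proj1 (proj2_sig c);
     ity_square := proj2 (proj2_sig c) |}.

End IsoEq.

Lemma iso_refl_square (Γ : iso_cwf) (A : ty Γ) (a : tm A) :
  square (sing (refl R (itm a))) (ictx_map Γ) (ity_map (iso_Eq a a)).
Proof.
apply (square_into_Eq (ity_square (iso_Eq a a))). apply square_eq_id, wk_sing.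
Qed.

Lemma iso_Eq_sub (Γ Δ : iso_cwf) (A : ty Γ) (a b : tm A) (σ : sub Δ Γ) :
  (iso_Eq a b)⟦σ⟧ = iso_Eq (tm_sub σ eq_refl a) (tm_sub σ eq_refl b).
Proof.
symmetry. set (Q := iso_Eq _ _).
apply (@iso_ty_sub_eq _ _ (iso_Eq a b) Q σ (eq_sym (Eq_sub R (itm a) (itm b) (isub σ)))).
apply (square_into_Eq (ity_square (iso_Eq a b))).
refine (eq_ind_r (fun s => square s _ _) _ (wk_ext_map _)).
apply (square_comp (isub_square σ) (ity_square Q)).
Qed.

Definition iso_eq_structure : EqStructure iso_cwf.
Proof.
refine {| Eq := iso_Eq; Eq_sub := iso_Eq_sub;
  refl := fun Γ A a => Build_iso_tm (A := iso_Eq a a) (iso_refl_square a) |}.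
- intros Γ A a b t. apply iso_tm_eq, (Eq_reflection (itm t)).
- intros. apply iso_tm_eq, Eq_unique.
Defined.

Definition iso_Unit (Γ : iso_cwf) : ty Γ :=
  let c := constructive_indefinite_description _ (Unit_square_iso (ictx_iso Γ)) in
  {| ity := Unit R (ictx Γ);
     ity_map := proj1_sig c;
     ity_iso := proj1 (proj2_sig c);
     ity_square := proj2 (proj2_sig c) |}.

Lemma iso_star_square (Γ : iso_cwf) :
  square (sing (star R (ictx Γ))) (ictx_map Γ) (ity_map (iso_Unit Γ)).
Proof.
apply (square_into_Unit (ity_square (iso_Unit Γ))). apply square_eq_id, wk_sing.
Qed.

Lemma iso_Unit_sub (Γ Δ : iso_cwf) (σ : sub Δ Γ) : (iso_Unit Γ)⟦σ⟧ = iso_Unit Δ.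
Proof.
symmetry.
apply (@iso_ty_sub_eq _ _ (iso_Unit Γ) (iso_Unit Δ) σ (eq_sym (Unit_sub R (isub σ)))).
apply (square_into_Unit (ity_square (iso_Unit Γ))).
refine (eq_ind_r (fun s => square s _ _) _ (wk_ext_map _)).
apply (square_comp (isub_square σ) (ity_square (iso_Unit Δ))).
Qed.

Definition iso_unit_structure : UnitStructure iso_cwf.
Proof.
refine {| Unit := iso_Unit; Unit_sub := iso_Unit_sub;
  star := fun Γ => Build_iso_tm (A := iso_Unit Γ) (iso_star_square Γ) |}.
intros Γ t. apply iso_tm_eq, Unit_eta.
Defined.

(** * The universe of the iso-inserter *)

Definition iso_U : ty (@empty iso_cwf) :=
  let c := constructive_indefinite_description _ (U_square_iso (ictx_map iso_empty)) in
  Build_iso_ty (Γ := iso_empty) (proj1 (proj2_sig c)) (proj1 (proj2 (proj2_sig c))).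

Lemma iso_U_map :
  weak_U G ∘ ext_cmp G (U R) ∘ ity_map iso_U = weak_U F ∘ ext_cmp F (U R).
Proof.
apply (proj2_sig (constructive_indefinite_description _ (U_square_iso (ictx_map iso_empty)))).
Qed.

Definition iso_El : ty (@empty iso_cwf ▷ iso_U) :=
  let c := constructive_indefinite_description _ (El_square_iso iso_U_map) in
  Build_iso_ty (Γ := iso_ext iso_U) (proj1 (proj2_sig c)) (proj1 (proj2 (proj2_sig c))).

Lemma iso_El_map :
  weak_El G ∘ ext_cmp G (El R) ∘ ity_map iso_El = weak_El F ∘ ext_cmp F (El R).
Proof.
apply (proj2_sig (constructive_indefinite_description _ (El_square_iso iso_U_map))).
Qed.

Definition iso_rf : RFCat :=
  {| cwf := iso_cwf;
     pi_str := iso_pi_structure;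
     sigma_str := iso_sigma_structure;
     eq_str := iso_eq_structure;
     unit_str := iso_unit_structure;
     universe := {| U := iso_U; El := iso_El |} |}.

End IsoInserter.

(** * The section of the projection *)

Section Identity.
Variable R : RFCat.

Definition id_pre_mor : CwFPreMor R R.
Proof.
refine {| on_ctx := fun Γ : R => Γ; on_sub := fun Γ Δ σ => σ;
  on_ty := fun Γ A => A; on_tm := fun Γ A a => a |}; try reflexivity.
intros. apply tm_sub_irr.
Defined.

Lemma id_ext_cmp (Γ : R) (A : ty Γ) : ext_cmp id_pre_mor A = id_sub (Γ ▷ A).
Proof.
unfold ext_cmp. simpl.
rewrite <- (ext_map_cast_var (eq_refl A⟦wk A⟧) eq_refl).
symmetry. apply lift_sing.
Qed.

Definition id_mor : CwFMor R R.
Proof.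
refine {| pre_mor := id_pre_mor; ext_inv := fun Γ A => id_sub (Γ ▷ A) |}.
- intros Γ. exists (bang Γ). apply bang_unique.
- intros. rewrite id_ext_cmp. apply comp_id_l.
- intros. rewrite id_ext_cmp. apply comp_id_l.
Defined.

Definition id_split_mor : SplitRFMor R R.
Proof.
refine {| split_mor := id_mor |}.
- split; [reflexivity|]. intros Γ A. simpl. rewrite id_ext_cmp. constructor.
- intros Γ A B.
  assert (K : on_fam id_mor B = B) by apply ty_sub_id.
  (* [on_fam id_mor B] is [B⟦id_sub _⟧], equal to [B] only by a proved equation. Abstracting it as
     [B'] lets the equation be eliminated. *)
  assert (L : forall (B' : ty (Γ ▷ A)) (h : B' = B⟦id_sub _⟧), B' = B ->
    exists e : Pi R B = Pi R B',
    forall b : tm B, tm_cast e (lam R b) = lam R (tm_sub (id_sub _) h b)).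
  { intros B' h K'. revert h. rewrite K'. intros h. exists eq_refl. intros b. rewrite tm_sub_id. reflexivity. }
  exact (L _ eq_refl K).
- intros Γ A B. 
  assert (K : on_fam id_mor B = B) by apply ty_sub_id.
  assert (L : forall (B' : ty (Γ ▷ A)) (K : B' = B), exists e : Sigma R B = Sigma R B',
    forall (a : tm A) (b : tm B⟦sing a⟧) (e' : B⟦sing a⟧ = B'⟦sing a⟧),
    tm_cast e (spair R b) = spair R (tm_cast e' b)).
  { intros B' K'. subst B'. exists eq_refl. intros a b e'.
    rewrite (tm_cast_irr e' eq_refl). reflexivity. }
  destruct (L _ K) as [e He]. exists e. intros a b. apply He.
- intros Γ A a b. reflexivity.
- intros Γ. reflexivity.
- assert (e : U R = (U R)⟦bang empty⟧).
  { rewrite <- (bang_unique (id_sub _)). symmetry. apply ty_sub_id. }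
  exists e. simpl. rewrite id_ext_cmp.
  rewrite ext_map_eq_id by (symmetry; apply bang_unique).
  rewrite comp_id_l. symmetry. apply ty_sub_id.
Defined.

End Identity.

Section Projection.
Variables (R S : RFCat) (F G : WeakRFMor R S) (K : SplitRFMor R (iso_rf F G)).

(** The composite of [K] with the projection from the iso-inserter, written out directly instead of
    through a general composition of morphisms. *)
Definition proj_pre_mor : CwFPreMor R R.
Proof.
refine {|
  on_ctx := fun Γ => ictx (K Γ);
  on_sub := fun Γ Δ σ => isub (on_sub K σ);
  on_ty := fun Γ A => ity (on_ty K A);
  on_tm := fun Γ A a => itm (on_tm K a) |}.
- intros Γ. exact (f_equal (@isub _ _ _ _ _ _) (on_id K Γ)).
- intros Γ Δ Θ σ τ. exact (f_equal (@isub _ _ _ _ _ _) (on_comp K σ τ)).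
- intros Γ Δ A σ. exact (f_equal (@ity _ _ _ _ _) (on_ty_sub K A σ)).
- intros. rewrite (on_tm_sub e (eq_trans (f_equal _ e) (on_ty_sub K A σ))). apply tm_sub_irr.
Defined.

Lemma proj_ext_cmp (Γ : R) (A : ty Γ) : ext_cmp proj_pre_mor A = isub (ext_cmp K A).
Proof.
unfold ext_cmp. simpl. f_equal. symmetry.
apply (itm_cast _ (f_equal (@ity _ _ _ _ _) (on_ty_sub K A (wk A)))).
Qed.

Lemma proj_empty : is_terminal (proj_pre_mor empty).
Proof.
refine (eq_ind_r (is_terminal (C := R)) _
  (f_equal (@ictx _ _ _ _) (proj1 (split_is_split K)))).
intros Γ. exists (bang Γ). apply bang_unique.
Qed.

Definition proj_mor : CwFMor R R.
Proof.
refine {| pre_mor := proj_pre_mor; ext_inv := fun Γ A => isub (ext_inv K A) |}.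
- exact proj_empty.
- intros. rewrite proj_ext_cmp. exact (f_equal (@isub _ _ _ _ _ _) (ext_inv_l K A)).
- intros. rewrite proj_ext_cmp. exact (f_equal (@isub _ _ _ _ _ _) (ext_inv_r K A)).
Defined.

Lemma proj_ext_map_ext_cmp (Γ : R) (A : ty Γ) (Δ : iso_rf F G) (B : ty Δ)
    (σ : sub (K Γ) Δ) (e : on_ty K A = B⟦σ⟧) (e' : on_ty proj_mor A = (ity B)⟦isub σ⟧) :
  ext_map e' ∘ ext_cmp proj_mor A = isub (ext_map e ∘ ext_cmp K A).
Proof.
exact (f_equal2 (fun s t => s ∘ t) (eq_sym (isub_ext_map e e')) (proj_ext_cmp A)).
Qed.

Lemma isub_identity (Γ Δ : iso_rf F G) (σ : sub Γ Δ) :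
  is_identity σ -> is_identity (isub σ).
Proof. intros []. constructor. Qed.

Definition proj_split_mor : SplitRFMor R R.
Proof.
refine {| split_mor := proj_mor |}.
- split.
  + exact (f_equal (@ictx _ _ _ _) (proj1 (split_is_split K))).
  + intros Γ A. simpl. rewrite proj_ext_cmp.
    exact (isub_identity (proj2 (split_is_split K) Γ A)).
- intros Γ A B. destruct (split_Pi K B) as [e He].
  exists (f_equal (@ity _ _ _ _ _) e). intros b.
  refine (eq_trans (eq_sym (itm_cast e _ _)) _). rewrite He. reflexivity.
- intros Γ A B. destruct (split_Sigma K B) as [e He].
  exists (f_equal (@ity _ _ _ _ _) e). intros a b.
  refine (eq_trans (eq_sym (itm_cast e _ _)) _). rewrite He.
  exact (f_equal (fun x => spair R x)
    (itm_cast (on_fam_sing K B a) (on_fam_sing proj_mor B a) (on_tm K b))).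
- intros Γ A a b. exact (f_equal (@ity _ _ _ _ _) (split_Eq K a b)).
- intros Γ. exact (f_equal (@ity _ _ _ _ _) (split_Unit K Γ)).
- destruct (split_universe K) as [e He].
  exists (f_equal (@ity _ _ _ _ _) e).
  rewrite (proj_ext_map_ext_cmp e).
  exact (f_equal (@ity _ _ _ _ _) He).
Defined.

Definition component (Γ : R) : sub (F (proj_mor Γ)) (G (proj_mor Γ)) := ictx_map (K Γ).

Lemma component_iso Γ : is_iso (component Γ).
Proof. apply ictx_iso. Qed.

Lemma component_natural Γ Δ (σ : sub Δ Γ) :
  square (on_sub proj_mor σ) (component Δ) (component Γ).
Proof. apply (isub_square (on_sub K σ)). Qed.

(** [K] preserves the universe, so the comparison into [iso_U] is a substitution of the iso-inserter
    and carries a square. Quantifying over [e] keeps [K] out of the equations, so that [proj_mor]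
    can later be replaced by the identity. *)
Lemma component_U :
  exists u, weak_U G ∘ ext_cmp G (U R) ∘ u = weak_U F ∘ ext_cmp F (U R) /\
  forall e : on_ty proj_mor (U R) = (U R)⟦bang (proj_mor empty)⟧,
    square (ext_map e ∘ ext_cmp proj_mor (U R)) (component (empty ▷ U R)) u.
Proof.
exists (ity_map (iso_U F G)). split; [apply iso_U_map|].
intros e. destruct (split_universe K) as [e' _].
rewrite (proj_ext_map_ext_cmp e'). apply (isub_square (ext_map e' ∘ ext_cmp K (U R))).
Qed.

Lemma component_El :
  exists v, weak_El G ∘ ext_cmp G (El R) ∘ v = weak_El F ∘ ext_cmp F (El R) /\
  forall (e : on_ty proj_mor (U R) = (U R)⟦bang (proj_mor empty)⟧)
    (e' : on_ty proj_mor (El R) = (El R)⟦ext_map e ∘ ext_cmp proj_mor (U R)⟧),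
    square (ext_map e' ∘ ext_cmp proj_mor (El R)) (component (empty ▷ U R ▷ El R)) v.
Proof.
exists (ity_map (iso_El F G)). split; [apply iso_El_map|].
intros e. destruct (split_universe K) as [d d'].
rewrite (proj_ext_map_ext_cmp d). intros e'.
rewrite (proj_ext_map_ext_cmp d'). apply (isub_square (ext_map d' ∘ ext_cmp K (El R))).
Qed.

End Projection.

Theorem mainTheorem8 (RF0 : RFCat) (hRF0 : is_initial RF0) (C : RFCat)
    (F G : WeakRFMor RF0 C) : isomorphic F G.
Proof.
destruct (hRF0 (iso_rf F G)) as [K _].
destruct (hRF0 RF0) as [I HI].
(* Both are split RF-endomorphisms of an initial object. *)
assert (E : proj_split_mor K = id_split_mor RF0)
  by (rewrite (HI (proj_split_mor K)); symmetry; apply HI).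
(* The types of the components depend on the projected morphism. With [φ] bound by the existential,
   that morphism occurs only as [proj_split_mor K], so the whole statement can be rewritten along
   [E]. *)
assert (H : exists φ : forall Γ, sub (F (proj_split_mor K Γ)) (G (proj_split_mor K Γ)),
  (forall Γ, is_iso (φ Γ)) /\
  (forall Γ Δ (σ : sub Δ Γ), square (on_sub (proj_split_mor K) σ) (φ Δ) (φ Γ)) /\
  (exists u, weak_U G ∘ ext_cmp G (U RF0) ∘ u = weak_U F ∘ ext_cmp F (U RF0) /\
  forall e : on_ty (proj_split_mor K) (U RF0) = (U RF0)⟦bang _⟧,
    square (ext_map e ∘ ext_cmp (proj_split_mor K) (U RF0)) (φ (empty ▷ U RF0)) u) /\
  exists v, weak_El G ∘ ext_cmp G (El RF0) ∘ v = weak_El F ∘ ext_cmp F (El RF0) /\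
  forall (e : on_ty (proj_split_mor K) (U RF0) = (U RF0)⟦bang _⟧)
    (e' : on_ty (proj_split_mor K) (El RF0)
      = (El RF0)⟦ext_map e ∘ ext_cmp (proj_split_mor K) (U RF0)⟧),
    square (ext_map e' ∘ ext_cmp (proj_split_mor K) (El RF0)) (φ (empty ▷ U RF0 ▷ El RF0)) v).
{ exists (component K). split; [apply component_iso|]. split; [apply component_natural|].
  split; [apply component_U|apply component_El]. }
rewrite E in H. destruct H as [φ [H1 [H2 [[u [H3 H4]] [v [H5 H6]]]]]].
exists φ. split; [exact H1|]. split; [exact H2|].
destruct (split_universe (id_split_mor RF0)) as [e e'].
(* For the identity morphism the universe comparisons are identities, so the squares of [H4] and
   [H6] identify [u] and [v] with components of [φ]. *)
assert (L : ext_map e ∘ ext_cmp (id_split_mor RF0) (U RF0) = id_sub _).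
{ simpl. rewrite id_ext_cmp, comp_id_r. apply ext_map_eq_id. symmetry. apply bang_unique. }
assert (Hu : φ (empty ▷ U RF0) = u).
{ specialize (H4 e). rewrite L in H4. unfold square in H4.
  rewrite !on_id, comp_id_l, comp_id_r in H4. symmetry. exact H4. }
assert (L' : ext_map e' ∘ ext_cmp (id_split_mor RF0) (El RF0) = id_sub _).
{ simpl. rewrite (id_ext_cmp (El RF0)), comp_id_r. apply (ext_map_eq_id e'). exact L. }
assert (Hv : φ (empty ▷ U RF0 ▷ El RF0) = v).
{ specialize (H6 e e'). rewrite L' in H6. unfold square in H6.
  rewrite !on_id, comp_id_l, comp_id_r in H6. symmetry. exact H6. }
unfold ty_component. split.
- rewrite Hu, !comp_assoc, H3, <- comp_assoc, ext_inv_r. apply comp_id_r.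
- rewrite Hv, !comp_assoc, H5, <- comp_assoc, ext_inv_r. apply comp_id_r.
Qed.
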